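(* Let $\beta>0$ and $\mu>0$, put $\eta=\beta/\mu$, and suppose that the first scattering depth variable $x$ and the step sizes $Y_i$ are all exponentially distributed with rate $\mu$, i.e. with density $\mu e^{-\mu y}$ on $y\ge 0$. With $\rho$, $\rho^u$, $\hat\rho_\theta$ the quantities defined in the context: (i) (Upper bound, normal incidence.) If $2\eta<1$, then $$\rho\le\rho^u=\frac{\left(1-\sqrt{\frac{2\eta}{1+2\eta}}\right)^{1/2}\left(\frac{1}{1-2\eta}\right)^{1/2}}{1+\eta+\frac12\sqrt{\frac{2\eta}{1+2\eta}}}.$$ (ii) (Approximation, normal incidence.) The approximation $\hat\rho=\hat\rho_0$ of $\rho$ is $$\hat\rho=\frac{1-\sqrt{\frac{2\eta}{2\eta+1}}}{\eta+1+\sqrt{\frac{2\eta}{2\eta+1}}}\,(1+\eta).$$ (iii) (Approximation, incident angle $\theta$.) For every $\theta\in[0,\pi/2)$, $$\hat\rho_\theta=\left(1-\sqrt{\frac{2\eta}{1+2\eta}}\right)\left(1+\left(\eta+\sqrt{\frac{2\eta}{1+2\eta}}\right)\cos\theta\right)^{-1}(1+\eta).$$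
   Context: Model of a one-sided flat Beerian porous medium with opaque particles and dissipation factor $\beta$. A beam of unit power enters the half-line of depths $[0,\infty)$ and is first scattered at a random depth (for normal incidence) $x\ge 0$. The subsequent scattering depths form a random walk. Let $Y_1,Y_2,\dots$ be i.i.d. positive step sizes (with $Y$ denoting a generic copy), let $s_1,s_2,\dots$ be i.i.d. signs, uniform on $\{1,-1\}$, and let $x$, $(Y_i)$, $(s_i)$ be mutually independent. For a starting depth $u\ge0$ define the stopping time $$T_u=\min\Big\{T\ge 1: u+\sum_{i=1}^{T}s_iY_i<0\Big\},$$ the overshoot $$Z_u=-u-\sum_{i=1}^{T_u}s_iY_i>0,$$ and the total travel $L_u=\sum_{i=1}^{T_u}Y_i$. In the formulas below, $\mathbb{E}_x$ denotes expectation over $x$, and $\mathbb{E}$ inside it denotes expectation over the walk with the starting depth held fixed. Reflected power fraction (Beer's law, normal incidence): $$\rho=\mathbb{E}_x\Big(e^{-\beta x}\,\mathbb{E}\,e^{-\beta L_x+\beta|Z_x|}\Big).$$ Upper-bound quantity: $$\rho^u=\mathbb{E}_x\left(e^{-\beta x}\sqrt{\mathbb{E}\big[(\mathbb{E}e^{-2\beta Y})^{T_x}\big]\;\mathbb{E}\big[e^{2\beta|Z_x|}\big]}\right).$$ Approximation (delta method) at incident angle $\theta$: put $\tilde x=x\cos\theta$ and, for $u\ge 0$, $$\Delta(u)=\lim_{\epsilon\to0^+}\frac{\mathbb{E}e^{-2\epsilon Z_u/\mathbb{E}\tilde x}-\mathbb{E}e^{-\epsilon Z_u/\mathbb{E}\tilde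 x}}{\epsilon/\mathbb{E}\tilde x},$$ and define $$\hat\rho_\theta=\mathbb{E}_x\Big(e^{-\beta\tilde x}\;\mathbb{E}\big[(\mathbb{E}e^{-2\beta Y})^{T_{\tilde x}}\big]\;\big(1-\beta\,\Delta(\tilde x)\big)\Big).$$ *)

(* Defs.v *)
From HB Require Import structures.
From mathcomp Require Import all_boot all_order all_algebra finmap.
From mathcomp Require Import all_classical all_reals all_analysis.

Set Implicit Arguments.
Unset Strict Implicit.
Unset Printing Implicit Defensive.

Import Order.TTheory GRing.Theory Num.Theory.
Import numFieldNormedType.Exports.

Local Open Scope classical_set_scope.
Local Open Scope ring_scope.
Local Open Scope ereal_scope.

Definition mutually_independent (d : measure_display) (T : measurableType d)
    (R : realType) (P : probability T R) (I : choiceType) (X : I -> T -> R) :=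
  forall (J : {fset I}) (A : I -> set R), (forall i, measurable (A i)) ->
    P (\bigcap_(i in [set` J]) X i @^-1` A i)
    = \prod_(i <- J) P (X i @^-1` A i).

Definition exponentially_distributed (d : measure_display)
    (T : measurableType d) (R : realType) (P : probability T R)
    (X : {RV P >-> R}) (mu : R) :=
  forall A : set R, measurable A ->
    distribution P X A = exponential_prob mu A.

Definition uniform_sign (d : measure_display) (T : measurableType d)
    (R : realType) (P : probability T R) (S : {RV P >-> R}) :=
  distribution P S [set 1%R] = (2^-1)%:E /\
  distribution P S [set (-1)%R] = (2^-1)%:E.

Definition all_variables (T : Type) (R : realType) (x : T -> R)
    (Y s : nat -> T -> R) (i : option (nat + nat)) : T -> R :=
  match i with
  | None => x
  | Some (inl n) => Y n
  | Some (inr n) => s n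
  end.

(* The steps are indexed from 0, so [walk Y s u n] is the depth after n steps. *)
Definition walk (T : Type) (R : realType) (Y s : nat -> T -> R) (u : R)
    (n : nat) (w : T) : R :=
  (u + \sum_(i < n) s i w * Y i w)%R.

(* Paths that never leave the half-line get the value 0; for i.i.d. positive
   steps with uniform independent signs they form a null event. *)
Definition exit_time (T : Type) (R : realType) (Y s : nat -> T -> R) (u : R)
    (w : T) : nat :=
  match pselect (exists n, (0 < n)%N && (walk Y s u n w < 0)%R) with
  | left ex => ex_minn ex
  | right _ => 0%N
  end.

Definition overshoot (T : Type) (R : realType) (Y s : nat -> T -> R) (u : R)
    (w : T) : R :=
  (- u - \sum_(i < exit_time Y s u w) s i w * Y i w)%R.

Definition travel (T : Type) (R : realType) (Y s : nat -> T -> R) (u : R)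
    (w : T) : R :=
  (\sum_(i < exit_time Y s u w) Y i w)%R.

(* In the nested expectations below the outer variable [w] only supplies the
   starting depth, which is held fixed in the inner expectation. *)
Definition rho (d : measure_display) (T : measurableType d) (R : realType)
    (P : probability T R) (x : T -> R) (Y s : nat -> T -> R) (beta : R)
    : \bar R :=
  \int[P]_w ((expR (- beta * x w)%R)%:E *
    'E_P[fun v => expR (- beta * travel Y s (x w) v
                        + beta * `|overshoot Y s (x w) v|)%R]).

(* E e^{-2 beta Y}, with Y 0 as the generic copy. *)
Definition step_transform (d : measure_display) (T : measurableType d)
    (R : realType) (P : probability T R) (Y : nat -> T -> R) (beta : R) : R :=
  fine 'E_P[fun v => expR (- (2 * beta) * Y 0%N v)%R].

Definition rho_upper (d : measure_display) (T : measurableType d)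
    (R : realType) (P : probability T R) (x : T -> R) (Y s : nat -> T -> R)
    (beta : R) : \bar R :=
  \int[P]_w ((expR (- beta * x w)%R)%:E *
    sqrte ('E_P[fun v => (step_transform P Y beta ^+ exit_time Y s (x w) v)%R] *
           'E_P[fun v => expR (2 * beta * `|overshoot Y s (x w) v|)%R])).

(* [m] stands for the mean of the projected first scattering depth. *)
Definition delta (d : measure_display) (T : measurableType d) (R : realType)
    (P : probability T R) (Y s : nat -> T -> R) (m u : R) : \bar R :=
  lim (('E_P[fun v => expR (- (2 * eps) * overshoot Y s u v / m)%R]
        - 'E_P[fun v => expR (- eps * overshoot Y s u v / m)%R])
       * ((eps / m)^-1)%R%:E @[eps --> (0 : R)^'+]).

Definition rho_hat (d : measure_display) (T : measurableType d) (R : realType)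
    (P : probability T R) (x : T -> R) (Y s : nat -> T -> R)
    (beta theta : R) : \bar R :=
  let xt := (fun w => x w * cos theta)%R in
  \int[P]_w ((expR (- beta * xt w)%R)%:E *
    'E_P[fun v => (step_transform P Y beta ^+ exit_time Y s (xt w) v)%R] *
    (1 - beta%:E * delta P Y s (fine 'E_P[xt]) (xt w))).

(* Main.v *)
(* Fix the starting depth [u] and put, with [S n] the walk, [W n] the product
   of the weights [z e^(-a Y_i)] of the first [n] steps, set to 0 once the walk
   has left the half-line.  An exponential step of weight [e^(-a y)] sends
   [e^(-lam v)] to a multiple of itself minus a multiple of [e^(-(mu+a) v)], the
   boundary term.  When [lam^2 = (mu+a)^2 - z mu (mu+a)] the first multiple is 1,
   so [E (W n e^(-lam (S n)))] telescopes and sums the boundary terms.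
   By lack of memory the contribution to [E (z^T e^(-a L + c Z))] of an exit at
   step [n + 1] is another multiple of the same boundary term, whence
     [E (z^T e^(-a L + c Z)) = (mu + a - lam) / (mu + a - c) e^(-lam u)].
   In the recurrent case [z = 1], [a = 0], the formula is the limit [lam -> 0].
   All quantities of the theorem are instances of this identity, integrated
   against the exponential law of the first depth; the upper bound becomes an
   elementary inequality between closed forms. *)

Require Import Defs.
From HB Require Import structures.
From mathcomp Require Import all_boot all_order all_algebra finmap.
From mathcomp Require Import all_classical all_reals all_analysis.
From mathcomp Require Import measurable_realfun measurable_fun_approximation.
From mathcomp Require Import simple_functions ring lra.
Import Order.TTheory GRing.Theory Num.Theory.
Import numFieldNormedType.Exports.
Local Open Scope classical_set_scope.
Local Open Scope ring_scope.

Set Implicit Arguments.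
Unset Strict Implicit.
Unset Printing Implicit Defensive.

(** * Integration against exponential laws *)

Section integration.
Local Open Scope ereal_scope.
Context (d : measure_display) (T : measurableType d) (R : realType).
Implicit Types (mu nu : {measure set T -> \bar R}) (f g : T -> \bar R).

(* Unlike [ge0_le_integral], no measurability is needed. *)
Lemma ge0_le_integralT mu f g : (forall t, 0 <= f t) ->
  (forall t, f t <= g t) -> \int[mu]_t f t <= \int[mu]_t g t.
Proof.
move=> f0 fg; have g0 t : 0 <= g t by exact: le_trans (fg t).
rewrite !ge0_integralTE//; apply: le_ereal_sup => _ [h hf <-].
by exists h => // t; exact: le_trans (fg t).
Qed.

Lemma measurable_fun_natb (b : T -> bool) : measurable_fun setT b ->
  measurable_fun setT (fun t => (b t)%:R%R : R).
Proof.
move=> mb; rewrite (_ : (fun _ => _) = fun t => if b t then 1%R else 0%R : R).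
  exact: measurable_fun_ifT.
by apply/funext => t; case: (b t).
Qed.

(* [f] need not be measurable: the nested expectations of the theorem are only
   known in closed form at nonnegative depths. *)
Lemma eq_integral_null mu (N : set T) f g : measurable N -> mu N = 0 ->
  measurable_fun setT g -> (forall t, ~ N t -> f t = g t) ->
  \int[mu]_t f t = \int[mu]_t g t.
Proof.
move=> mN N0 mg fg.
have mNb : measurable_fun setT (fun t => t \in N).
  apply: (measurable_fun_bool true); rewrite setTI.
  rewrite (_ : _ @^-1` _ = N)//.
  by apply/seteqP; split=> t /=; [move/set_mem|move/mem_set].
have patched h (c : \bar R) : measurable_fun setT h -> (forall t, 0 <= h t) ->
    0 <= c -> \int[mu]_t (if t \in N then c else h t) = \int[mu]_t h t.
  move=> mh h0 c0; apply: ge0_ae_eq_integral => //.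
  - exact: measurable_fun_ifT.
  - by move=> t _; case: ifP.
  - exists N; split=> // t /= ht; apply: contrapT => tN.
    by apply: ht => _; rewrite memNset.
(* The possibly non-measurable [f'] is squeezed between two measurable functions that equal [g'] off
   [N] and take the values [0] and [+oo] on it; both have the integral of [g']. *)
have ge0_case f' g' : measurable_fun setT g' ->
    (forall t, 0 <= f' t) -> (forall t, 0 <= g' t) ->
    (forall t, ~ N t -> f' t = g' t) -> \int[mu]_t f' t = \int[mu]_t g' t.
  move=> mg' f0 g0 fg'; apply/eqP; rewrite eq_le; apply/andP; split.
    rewrite -(patched g' +oo)//; apply: ge0_le_integralT => // t.
    by case: ifPn; [rewrite leey|rewrite notin_setE => /fg' ->].
  rewrite -(patched g' 0)//; apply: ge0_le_integralT => t.
    by case: ifP.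
  by case: ifPn => //; rewrite notin_setE => /fg' ->.
rewrite [LHS]integralE [RHS]integralE; congr (_ - _); apply: ge0_case => //.
- exact: measurable_funepos.
- by move=> t nt; rewrite !funeposE fg.
- exact: measurable_funeneg.
- by move=> t nt; rewrite !funenegE fg.
Qed.

Import HBNNSimple.

(** Monotone convergence along the simple approximations [h n] of [f] reduces both sides to level
    sets of [h n], where the density hypothesis applies. *)
Lemma ge0_integral_density nu mu (p : T -> R) f :
  measurable_fun setT p -> (forall t, (0 <= p t)%R) ->
  (forall A, measurable A -> nu A = \int[mu]_(t in A) (p t)%:E) ->
  measurable_fun setT f -> (forall t, 0 <= f t) ->
  \int[nu]_t f t = \int[mu]_t (f t * (p t)%:E).
Proof.
move=> mp p0 nuE mf f0; pose h := nnsfun_approx measurableT mf.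
have mp' : measurable_fun setT (EFin \o p) by exact/measurable_EFinP.
have -> : \int[nu]_t f t = limn (fun n => \int[nu]_t (h n t)%:E).
  rewrite -monotone_convergence//=.
  - by apply: eq_integral => t _; apply/esym/cvg_lim => //; exact: cvg_nnsfun_approx.
  - by move=> n; exact/measurable_EFinP.
  - by move=> n t _; rewrite lee_fin.
  - by move=> t _ a b ab; rewrite lee_fin; exact/lefP/nd_nnsfun_approx.
have -> : \int[mu]_t (f t * (p t)%:E)
    = limn (fun n => \int[mu]_t ((h n t)%:E * (p t)%:E)).
  rewrite -monotone_convergence//=.
  - apply: eq_integral => t _; apply/esym/cvg_lim => //; apply: cvgeZr => //.
    exact: cvg_nnsfun_approx.
  - by move=> n; apply/emeasurable_funM => //; exact/measurable_EFinP.
  - by move=> n t _; rewrite mule_ge0 ?lee_fin.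
  - by move=> t _ a b ab; rewrite lee_wpmul2r ?lee_fin//; exact/lefP/nd_nnsfun_approx.
congr (limn _); apply/funext => n.
have mi r : measurable_fun setT (fun t => (r * \1_(h n @^-1` [set r]) t)%:E).
  by apply/measurable_EFinP; exact: measurable_funM.
under eq_integral do rewrite fimfunE -fsumEFin//.
under [RHS]eq_integral => t _.
  rewrite fimfunE -fsumEFin// ge0_mule_fsuml; last first.
    by move=> r; exact: nnfun_muleindic_ge0.
  over.
rewrite !ge0_integral_fsum//; first last.
- by move=> r t _; exact: nnfun_muleindic_ge0.
- by move=> r t _; rewrite mule_ge0 ?lee_fin// -lee_fin nnfun_muleindic_ge0.
- by move=> r; apply: emeasurable_funM.
apply: eq_fsbigr => r rh; rewrite integralZl_indic_nnsfun//.
under [RHS]eq_integral do rewrite EFinM -muleA.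
rewrite ge0_integralZl//; first last.
- by move: rh; rewrite inE => -[t _ <-]; rewrite lee_fin.
- by move=> t _; rewrite mule_ge0 ?lee_fin.
- by apply: emeasurable_funM => //; exact/measurable_EFinP.
rewrite integral_indic// setIT nuE// [in RHS](eq_integral ((EFin \o p) \_ (h n @^-1` [set r]))).
  by rewrite -integral_mkcond.
by move=> t _; rewrite muleC epatch_indic.
Qed.

End integration.

(** * Exponential laws: moments, tails and null events *)

Section exponential.
Local Open Scope ereal_scope.
Context (R : realType).

Lemma integral_expR_tail (k b : R) : (0 < k)%R ->
  \int[lebesgue_measure]_(y in `[b, +oo[) (expR (- k * y))%:E
  = (expR (- k * b) / k)%:E.
Proof.
move=> k0.
have cE : continuous (fun y : R => expR (- k * y)).
  move=> y; apply: continuous_comp; last exact: continuous_expR.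
  by apply: continuousM => //; apply: cst_continuous.
have dE (y : R) : is_derive y (1%R : R) (fun y : R => - (expR (- k * y) / k))%R
    (expR (- k * y)).
  apply: is_derive_eq; rewrite /GRing.scale/=.
  by field; rewrite gt_eqF.
rewrite (@ge0_continuous_FTC2y _ _ (fun y => - (expR (- k * y) / k))%R b 0%R).
- by rewrite -EFinN -EFinD opprK add0r.
- by move=> y _; exact: expR_ge0.
- exact: continuous_subspaceT.
- rewrite -oppr0; apply: cvgN; rewrite -(mul0r k^-1%R); apply: cvgMl.
  rewrite (_ : (fun y => expR (- k * y)%R) =
               (fun z => expR (- z)%R) \o (fun z => k * z)%R); last first.
    by apply/funext => y /=; rewrite mulNr.
  apply: (@cvg_comp _ _ _ _ _ _ (pinfty_nbhs R)); last exact: cvgr_expR.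
  exact: gt0_cvgMry.
- move=> y _; exact: ex_derive.
- apply: cvg_at_right_filter; apply: cvgN; apply: cvgMl; exact: cE.
- by move=> y _; rewrite derive1E derive_val.
Qed.

Lemma integral_exponential (nu : {measure set (measurableTypeR R) -> \bar R})
    (mu : R) (f : R -> \bar R) :
  (forall A, measurable A -> nu A = exponential_prob mu A) -> (0 < mu)%R ->
  measurable_fun (setT : set (measurableTypeR R)) f -> (forall y, 0 <= f y) ->
  \int[nu]_y f y = \int[lebesgue_measure]_y (f y * (exponential_pdf mu y)%:E).
Proof.
move=> nuE mu0 mf f0.
apply: (@ge0_integral_density _ (measurableTypeR R) R nu lebesgue_measure
  (exponential_pdf mu)) => //.
- exact: measurable_exponential_pdf.
- by move=> y; apply: exponential_pdf_ge0; exact: ltW.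
Qed.

Context (d : measure_display) (T : measurableType d) (P : probability T R).

Lemma expectation_exponential (X : {RV P >-> R}) (mu : R) (f : R -> \bar R) :
  exponentially_distributed X mu -> (0 < mu)%R ->
  measurable_fun setT f -> (forall y, 0 <= f y) ->
  \int[P]_w f (X w) =
  \int[lebesgue_measure]_y (f y * (exponential_pdf mu y)%:E).
Proof.
(* The same function, retyped so that its law lives on the measurable space carrying Lebesgue
   measure. *)
move=> XE mu0 mf f0; pose X' : T -> measurableTypeR R := X.
have mX' : measurable_fun setT X' by exact: (measurable_funPT X).
rewrite -(@integral_exponential (pushforward P X'))//.
by rewrite (@ge0_integral_pushforward _ _ _ (measurableTypeR R)).
Qed.

(** Negative [k] is allowed as long as [mu + k] stays positive; this is what later gives exponential
    moments of the overshoot. *)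
Lemma expectation_exp_tail (X : {RV P >-> R}) (mu k b : R) :
  exponentially_distributed X mu ->
  (0 < mu)%R -> (0 < mu + k)%R -> (0 <= b)%R ->
  \int[P]_w (expR (- k * X w) * (b < X w)%R%:R)%:E
  = (mu / (mu + k) * expR (- (mu + k) * b))%:E.
Proof.
move=> XE mu0 muk0 b0.
have mb : measurable_fun setT (fun y : R => (b < y)%R).
  exact: measurable_fun_ltr.
have me (c : R) : measurable_fun setT (fun y : R => expR (c * y)).
  by apply: measurableT_comp => //; exact: measurable_funM.
rewrite (@expectation_exponential X mu
  (fun y => (expR (- k * y) * (b < y)%R%:R)%:E))//; first last.
- apply/measurable_EFinP; apply: measurable_funM => //.
  exact: measurable_fun_natb.
have mE : measurable_fun setT
    (fun y : measurableTypeR R => (expR (- (mu + k) * y))%:E).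
  by apply/measurable_EFinP; exact: me.
transitivity (\int[lebesgue_measure]_(y in `]b, +oo[)
    (mu%:E * (expR (- (mu + k) * y))%:E)).
  rewrite [RHS]integral_mkcond; apply: eq_integral => y _.
  rewrite patchE; case: ifPn => [|]; rewrite ?notin_setE ?inE/= in_itv/= andbT.
    move=> by_; rewrite by_ mulr1 exponential_pdfE; last first.
      by rewrite (le_trans b0)// ltW.
    rewrite -!EFinM; congr EFin; rewrite mulrCA -expRD; congr (_ * expR _)%R.
    by ring.
  by move=> /negP/negbTE ->; rewrite mulr0 mul0e.
rewrite ge0_integralZl//; first last.
- by rewrite lee_fin ltW.
- exact: measurable_funTS mE.
rewrite integral_itv_obnd_cbnd; last exact: measurable_funTS mE.
by rewrite integral_expR_tail// -EFinM; congr EFin; field; rewrite gt_eqF.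
Qed.

(** The density vanishes left of 0 and the point 0 has no mass. Identities known only at positive
    values can therefore be integrated. *)
Lemma exponential_null (X : {RV P >-> R}) (mu : R) :
  exponentially_distributed X mu -> P [set w | (X w <= 0)%R] = 0.
Proof.
move=> XE; rewrite (_ : [set w | _]%R = X @^-1` `]-oo, 0%R]%classic); last first.
  by apply/seteqP; split => w; rewrite /= in_itv.
have XI : P (X @^-1` `]-oo, 0%R]%classic) = exponential_prob mu `]-oo, 0%R]%classic.
  exact: XE.
rewrite XI.
rewrite /exponential_prob -(@integral_itv_bndo_bndc _ -oo%O 0%R)//; last first.
  by apply/measurable_funTS/measurable_EFinP; exact: measurable_exponential_pdf.
apply: integral0_eq => y /=; rewrite in_itv/= => y0.
by rewrite lt0_exponential_pdf.
Qed.

Lemma measurable_le0 (X : {RV P >-> R}) : measurable [set w | (X w <= 0)%R].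
Proof.
rewrite (_ : [set w | _]%R = X @^-1` `]-oo, 0%R]%classic); last first.
  by apply/seteqP; split => w; rewrite /= in_itv.
by rewrite -[_ @^-1` _]setTI; exact: (measurable_funPT X).
Qed.

Lemma expectation_exp (X : {RV P >-> R}) (mu k : R) :
  exponentially_distributed X mu -> (0 < mu)%R -> (0 < mu + k)%R ->
  \int[P]_w (expR (- k * X w))%:E = (mu / (mu + k))%:E.
Proof.
move=> XE mu0 muk0.
have me (c : R) : measurable_fun setT (fun y : R => expR (c * y)).
  by apply: measurableT_comp => //; exact: measurable_funM.
rewrite -[RHS](_ : (mu / (mu + k) * expR (- (mu + k) * 0))%:E = _); last first.
  by rewrite mulr0 expR0 mulr1.
rewrite -(expectation_exp_tail XE)//.
apply/esym/(eq_integral_null (measurable_le0 X)).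
- exact: exponential_null XE.
- by apply/measurable_EFinP; exact: measurableT_comp (me _) _.
- by move=> w /= /negP; rewrite -ltNge => ->; rewrite mulr1.
Qed.

End exponential.

(** * Independence of blocks of variables *)

Section independence.
Local Open Scope ereal_scope.
Context (d : measure_display) (T : measurableType d) (R : realType)
  (P : probability T R).

(** For fixed [F], both sides are finite measures in [E] that agree on a pi-system containing the
    whole space, hence on the sigma-algebra it generates. *)
Lemma indep_g_sigma (G : set (set T)) (F : set T) :
  G `<=` measurable -> setI_closed G -> G setT -> measurable F ->
  (forall E, G E -> P (E `&` F) = P E * P F) ->
  forall E, <<s G >> E -> P (E `&` F) = P E * P F.
Proof.
move=> Gm GI GT mF GF E sE.
have PF0 : (0 <= fine (P F))%R by rewrite fine_ge0.
have PFE : (fine (P F))%:E = P F by rewrite fineK// fin_num_measure.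
have H : forall E, <<s G >> E ->
    mrestr P mF E = mscale (NngNum PF0) P E.
  apply: (g_sigma_algebra_measure_unique G _ (fun=> setT)) => //.
  - by rewrite bigcup_const//; exists 0%N.
  - by move=> A GA; apply: (eq_trans (GF _ GA)); rewrite muleC -{1}PFE.
  - by move=> k; apply: (@le_lt_trans _ _ (P F)); [rewrite -[X in _ <= P X](setTI F)|rewrite ltey_eq fin_num_measure].
by apply: (eq_trans (H _ sE)); rewrite muleC -[in RHS]PFE.
Qed.

Context (I : choiceType) (X : I -> T -> R).
Hypothesis indep : mutually_independent P X.
Hypothesis mX : forall i, measurable_fun setT (X i).

(** A pi-system that generates the sigma-algebra of the variables indexed by [J]; measurability for
    that sigma-algebra expresses dependence on these variables alone. *)
Definition cylinder (J : {fset I}) : set (set T) :=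
  [set E | exists2 A : I -> set R, (forall i, measurable (A i)) &
    E = \bigcap_(i in [set` J]) X i @^-1` A i].

Lemma cylinder_measurable J : cylinder J `<=` measurable.
Proof.
move=> _ [A mA ->]; apply: fin_bigcap_measurable => // i _.
by rewrite -[_ @^-1` _]setTI; exact: mX.
Qed.

Lemma cylinderI J : setI_closed (cylinder J).
Proof.
move=> _ _ [A mA ->] [B mB ->]; exists (fun i => A i `&` B i).
  by move=> i; exact: measurableI.
by rewrite -bigcapI.
Qed.

Lemma cylinderT J : cylinder J setT.
Proof.
exists (fun=> setT) => //; apply/esym; rewrite -subTset => w _ i _.
by [].
Qed.

Lemma indep_cylinder (J K : {fset I}) E F : [disjoint J & K]%fset ->
  cylinder J E -> cylinder K F -> P (E `&` F) = P E * P F.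
Proof.
move=> JK [A mA ->] [B mB ->].
(* Gluing the two families makes the intersection a single cylinder over the union of [J] and [K],
   whose product splits by disjointness. *)
pose C i := if i \in J then A i else B i.
have mC i : measurable (C i) by rewrite /C; case: ifP.
have inJ i : i \in J -> C i = A i by rewrite /C => ->.
have inK i : i \in K -> C i = B i.
  by move=> iK; rewrite /C ifN//; exact: (fdisjointP_sym JK).
have -> : \bigcap_(i in [set` J]) X i @^-1` A i
    `&` \bigcap_(i in [set` K]) X i @^-1` B i
    = \bigcap_(i in [set` (J `|` K)%fset]) X i @^-1` C i.
  apply/seteqP; split => w.
    move=> [wA wB] i /=; rewrite in_fsetU => /orP[iJ|iK].
      by rewrite inJ//; exact: wA.
    by rewrite inK//; exact: wB.
  move=> wC; split => i /= iJ.
    by rewrite -inJ//; apply: wC; rewrite /= in_fsetU iJ.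
  by rewrite -inK//; apply: wC; rewrite /= in_fsetU iJ orbT.
rewrite !indep// (big_fsetID _ (mem J))/=; congr (_ * _).
- rewrite (_ : [fset i in _ | _]%fset = J); last first.
    by apply/fsetP => i; rewrite !inE/=; case: (i \in J); rewrite ?andbF.
  by apply: eq_big_seq => i iJ; rewrite inJ.
- rewrite (_ : [fset i in _ | _]%fset = K); last first.
    apply/fsetP => i; rewrite !inE/=; have [iJ|] := boolP (i \in J); last by rewrite andbT.
    by rewrite andbF; apply/esym/negbTE; exact: (fdisjointP JK).
  by apply: eq_big_seq => i iJ; rewrite inK.
Qed.

(** The pi-system argument is used twice, extending one factor at a time from cylinders to the
    generated sigma-algebra. *)
Lemma indep_sigma (J K : {fset I}) E F : [disjoint J & K]%fset ->
  <<s cylinder J >> E -> <<s cylinder K >> F -> P (E `&` F) = P E * P F.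
Proof.
move=> JK sE sF.
have mK : <<s cylinder K >> `<=` measurable.
  apply: smallest_sub; first exact: sigma_algebra_measurable.
  exact: cylinder_measurable.
apply: (indep_g_sigma (G := cylinder J)) => //.
- exact: cylinder_measurable.
- exact: cylinderI.
- exact: cylinderT.
- exact: mK.
- move=> {sE}E cE; rewrite setIC muleC.
  apply: (indep_g_sigma (G := cylinder K)) => //.
  + exact: cylinder_measurable.
  + exact: cylinderI.
  + exact: cylinderT.
  + exact: (cylinder_measurable cE).
  + by move=> {sF}F cF; rewrite setIC muleC; exact: indep_cylinder cE cF.
Qed.

Lemma measurable_cylinder J i : i \in J ->
  measurable_fun (setT : set (g_sigma_algebraType (cylinder J))) (X i).
Proof.
move=> iJ _ A mA; rewrite setTI; apply: sub_sigma_algebra.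
exists (fun j => if j == i then A else setT) => [j|]; first by case: ifP.
apply/seteqP; split => w /=.
  by move=> wA j jJ /=; case: eqP => // ->.
by move=> /(_ i iJ)/=; rewrite eqxx.
Qed.

(** The joint law of [Z] and [V] agrees with the product of their laws on rectangles, so the two are
    equal, and Tonelli's theorem applies. *)
Lemma indep_integral (J K : {fset I}) (d1 d2 : measure_display)
    (T1 : measurableType d1) (T2 : measurableType d2)
    (Z : T -> T1) (V : T -> T2) (f : T1 * T2 -> \bar R) :
  [disjoint J & K]%fset ->
  measurable_fun (setT : set (g_sigma_algebraType (cylinder J))) Z ->
  measurable_fun (setT : set (g_sigma_algebraType (cylinder K))) V ->
  measurable_fun setT f -> (forall z, 0 <= f z) ->
  \int[P]_w f (Z w, V w) = \int[P]_w \int[P]_v f (Z w, V v).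
Proof.
move=> JK mZ mV mf f0.
have sub L : <<s cylinder L >> `<=` measurable.
  apply: smallest_sub; first exact: sigma_algebra_measurable.
  exact: cylinder_measurable.
have mZT : measurable_fun (setT : set T) Z.
  by move=> _ A mA; apply: (sub J); exact: mZ.
have mVT : measurable_fun (setT : set T) V.
  by move=> _ A mA; apply: (sub K); exact: mV.
pose Z' : {mfun T >-> T1} := HB.pack Z (isMeasurableFun.Build _ _ _ _ Z mZT).
pose V' : {mfun T >-> T2} := HB.pack V (isMeasurableFun.Build _ _ _ _ V mVT).
have mZV : measurable_fun setT (fun w => (Z w, V w)).
  exact/measurable_fun_pair.
pose ZV : {mfun T >-> (T1 * T2)%type} :=
  HB.pack (fun w => (Z w, V w)) (isMeasurableFun.Build _ _ _ _ _ mZV).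
transitivity (\int[distribution P ZV]_z f z).
  by rewrite ge0_integral_distribution.
transitivity (\int[distribution P Z' \x distribution P V']_z f z).
  apply: eq_measure_integral => A mA _; apply/esym.
  apply: (@product_measure_unique _ _ _ _ _ (distribution P Z')
    (distribution P V') (distribution P ZV)) => //.
  move=> B C mB mC; rewrite /distribution /pushforward/=.
  apply: (@indep_sigma J K) => //.
    by have := mZ measurableT B mB; rewrite setTI.
  by have := mV measurableT C mC; rewrite setTI.
rewrite fubini_tonelli1// /fubini_F ge0_integral_distribution//; first last.
- by move=> z; exact: integral_ge0.
- exact: measurable_fun_fubini_tonelli_F.
apply: eq_integral => w _ /=; rewrite ge0_integral_distribution//.
exact: measurableT_comp.
Qed.

End independence.

(** * The weighted walk *)

Section walk.
Context (T : Type) (R : realType) (Y s : nat -> T -> R) (z a u : R).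

Definition weight (n : nat) (w : T) : R :=
  \prod_(i < n) (z * expR (- a * Y i w) * (0 <= walk Y s u i.+1 w)%R%:R).

Lemma walk0 w : walk Y s u 0 w = u.
Proof. by rewrite /walk big_ord0 addr0. Qed.

Lemma walkS n w : walk Y s u n.+1 w = walk Y s u n w + s n w * Y n w.
Proof. by rewrite /walk big_ord_recr/= addrA. Qed.

Lemma weight0 w : weight 0 w = 1.
Proof. by rewrite /weight big_ord0. Qed.

Lemma weightS n w : weight n.+1 w =
  weight n w * (z * expR (- a * Y n w) * (0 <= walk Y s u n.+1 w)%R%:R).
Proof. by rewrite /weight big_ord_recr. Qed.

Lemma weight_ge0 n w : 0 <= z -> 0 <= weight n w.
Proof.
by move=> z0; apply: prodr_ge0 => i _; rewrite !mulr_ge0 ?expR_ge0.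
Qed.

(** Lets the one-step formulas, valid at nonnegative depths only, be used wherever a weighted
    integrand is nonzero. *)
Lemma weight_walk_ge0 n w : 0 <= u -> weight n w != 0 -> 0 <= walk Y s u n w.
Proof.
case: n => [|n] u0; first by rewrite walk0.
by rewrite weightS !mulf_eq0 pnatr_eq0 eqb0 !negb_or negbK => /and3P[].
Qed.

Lemma weight_alive n w : (forall i, (i < n)%N -> 0 <= walk Y s u i.+1 w) ->
  weight n w = z ^+ n * expR (- a * \sum_(i < n) Y i w).
Proof.
elim: n => [|n IH] wge; first by rewrite weight0 big_ord0 mulr0 expR0 mulr1.
rewrite weightS IH => [|i /ltnW]; last exact: wge.
by rewrite wge// big_ord_recr/= mulr1 mulrDr expRD exprSr; ring.
Qed.

Lemma weight_dead n i w : (i < n)%N -> walk Y s u i.+1 w < 0 -> weight n w = 0.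
Proof.
move=> iltn wi; apply/eqP/prodf_eq0; exists (Ordinal iltn) => //=.
by rewrite leNgt wi mulr0.
Qed.

(** Only positive values are genuine exit times; 0 is the default on paths that never exit, treated
    in [exit_time0]. *)
Lemma exit_timeP w n : reflect
  ((forall i, (i < n)%N -> 0 <= walk Y s u i.+1 w) /\ walk Y s u n.+1 w < 0)
  (exit_time Y s u w == n.+1).
Proof.
rewrite /exit_time; case: pselect => [ex|nex].
  case: ex_minnP => m /andP[m0 wm] mmin.
  apply: (iffP eqP) => [mE|[wge wn]].
    subst m; split=> // i iltn; rewrite leNgt; apply/negP => wi.
    by have := mmin i.+1; rewrite wi => /(_ isT); rewrite ltnNge iltn.
  apply/eqP; rewrite eqn_leq mmin//=.
  case: m m0 wm {mmin} => // m _ wm; rewrite ltnNge; apply/negP => mn.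
  by have := wge m mn; rewrite leNgt wm.
by apply: (iffP eqP) => // -[_ wn]; exfalso; apply: nex; exists n.+1.
Qed.

Lemma exit_time0 w :
  exit_time Y s u w = 0%N <-> (forall n, 0 <= walk Y s u n.+1 w).
Proof.
rewrite /exit_time; case: pselect => [ex|nex]; split => //.
- by case: ex_minnP => -[].
- move=> wge; case: ex => -[//|n]/= wn; exfalso.
  by have := wge n; rewrite leNgt wn.
- move=> _ n; rewrite leNgt; apply/negP => wn.
  by apply: nex; exists n.+1.
Qed.

Lemma overshootE w : overshoot Y s u w = - walk Y s u (exit_time Y s u w) w.
Proof. by rewrite /overshoot /walk opprD. Qed.

Lemma overshoot_gt0 w : (0 < exit_time Y s u w)%N -> 0 < overshoot Y s u w.
Proof.
move=> T0; rewrite overshootE oppr_gt0.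
case E : exit_time T0 => [//|n] _.
by have /eqP/exit_timeP[] := E.
Qed.

(** The part of [z^T e^(-a L + c Z)] carried by an exit at step [n + 1], factored into the past and
    the last step. The survival factor of that step is replaced by the exit event, on which [Z] is
    minus the current depth. *)
Definition exit_term (c : R) (n : nat) (w : T) : R :=
  weight n w * (z * expR (- a * Y n w)) *
  ((walk Y s u n.+1 w < 0)%R%:R * expR (- c * walk Y s u n.+1 w)).

Lemma exit_termE c n w : exit_term c n w =
  (exit_time Y s u w == n.+1)%R%:R *
  (z ^+ exit_time Y s u w *
   expR (- a * travel Y s u w + c * overshoot Y s u w)).
Proof.
case: (exit_timeP w n) => [[wge wn]|nE].
  have /eqP TE : exit_time Y s u w == n.+1 by apply/exit_timeP.
  rewrite overshootE /travel TE /exit_term wn weight_alive//.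
  rewrite big_ord_recr/= !mul1r exprSr.
  rewrite (_ : - a * (_ + _) + _ = - a * (\sum_(i < n) Y i w) + - a * Y n w
    + - c * walk Y s u n.+1 w); last by ring.
  by rewrite !expRD; ring.
rewrite mul0r /exit_term; case: ltP => wn; last by rewrite mul0r mulr0.
have [i iltn wi] : exists2 i, (i < n)%N & walk Y s u i.+1 w < 0.
  apply: contrapT => nex; apply: nE; split => // i iltn.
  by rewrite leNgt; apply/negP => wi; apply: nex; exists i.
by rewrite (weight_dead iltn wi) !mul0r.
Qed.

Lemma exit_term_ge0 c n w : 0 <= z -> 0 <= exit_term c n w.
Proof. by move=> z0; rewrite !mulr_ge0 ?weight_ge0 ?expR_ge0. Qed.

(** Exits at different steps exclude each other, so at most one term of the series is nonzero. *)
Lemma nneseries_exit_term c w : 0 <= z ->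
  (\sum_(n <oo) (exit_term c n w)%:E = ((0 < exit_time Y s u w)%N%:R *
    (z ^+ exit_time Y s u w *
     expR (- a * travel Y s u w + c * overshoot Y s u w)))%:E)%E.
Proof.
move=> z0; case E : (exit_time Y s u w) => [|n].
  by rewrite mul0r eseries0// => n _ _; rewrite exit_termE E mul0r.
rewrite (nneseriesD1 (n := n))//; last by move=> k _; rewrite lee_fin exit_term_ge0.
rewrite eseries0 ?adde0; last first.
  by move=> k _ /= kn; rewrite exit_termE E eqSS eq_sym (negbTE kn) mul0r.
by rewrite exit_termE E eqxx.
Qed.

End walk.

(** Only the variables of the first [n] steps are assumed measurable, so that the sigma-algebra of
    the past is an admissible choice for [T]. *)
Lemma measurable_walk (d : measure_display) (T : measurableType d)
    (R : realType) (Y s : nat -> T -> R) (u : R) (n : nat) :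
  (forall i, (i < n)%N -> measurable_fun setT (Y i)) ->
  (forall i, (i < n)%N -> measurable_fun setT (s i)) ->
  measurable_fun setT (walk Y s u n).
Proof.
move=> mY ms; apply: measurable_funD => //.
apply: measurable_sum => i.
by apply: measurable_funM; [exact: ms|exact: mY].
Qed.

Lemma measurable_weight (d : measure_display) (T : measurableType d)
    (R : realType) (Y s : nat -> T -> R) (z a u : R) (n : nat) :
  (forall i, (i < n)%N -> measurable_fun setT (Y i)) ->
  (forall i, (i < n)%N -> measurable_fun setT (s i)) ->
  measurable_fun setT (weight Y s z a u n).
Proof.
elim: n => [|n IH] mY ms.
  by rewrite (_ : weight _ _ _ _ _ _ = cst 1)//; apply/funext => w; rewrite weight0.
rewrite (_ : weight _ _ _ _ _ _ = fun w => weight Y s z a u n w *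
  (z * expR (- a * Y n w) * (0 <= walk Y s u n.+1 w)%R%:R)); last first.
  by apply/funext => w; rewrite weightS.
apply: measurable_funM; first by apply: IH => i iltn; [apply: mY|apply: ms]; exact: ltnW.
apply: measurable_funM.
  apply: measurable_funM => //; apply: measurableT_comp => //.
  by apply: measurable_funM => //; exact: mY.
apply: measurable_fun_natb; apply: measurable_fun_ler => //.
exact: measurable_walk.
Qed.

Lemma measurable_exit_term (d : measure_display) (T : measurableType d)
    (R : realType) (Y s : nat -> T -> R) (z a u c : R) (n : nat) :
  (forall i, measurable_fun setT (Y i)) ->
  (forall i, measurable_fun setT (s i)) ->
  measurable_fun setT (exit_term Y s z a u c n).
Proof.
move=> mY ms; have mw : measurable_fun setT (walk Y s u n.+1).
  by apply: measurable_walk => i _; [exact: mY|exact: ms].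
apply: measurable_funM.
  apply: measurable_funM; first by apply: measurable_weight => i _.
  apply: measurable_funM => //; apply: measurableT_comp => //.
  exact: measurable_funM.
apply: measurable_funM.
  by apply: measurable_fun_natb; exact: measurable_fun_ltr.
by apply: measurableT_comp => //; exact: measurable_funM.
Qed.

(** * Conditioning one step on the past *)

Section one_step.
Local Open Scope ereal_scope.
Context (d : measure_display) (T : measurableType d) (R : realType)
  (P : probability T R).

(** The two values have total mass 1, so every other value of [S] is confined to a null event. *)
Lemma expectation_sign (S : {RV P >-> R}) (h : R -> \bar R) :
  uniform_sign S -> measurable_fun setT h -> (forall r, 0 <= h r) ->
  \int[P]_w h (S w) = 2^-1%:E * (h 1%R + h (-1)%R).
Proof.
move=> [S1 SN1] mh h0.
pose A := S @^-1` [set 1%R]; pose B := S @^-1` [set (-1)%R].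
have mA : measurable A by rewrite /A -[_ @^-1` _]setTI; exact: (measurable_funPT S).
have mB : measurable B by rewrite /B -[_ @^-1` _]setTI; exact: (measurable_funPT S).
have N11 : (-1 : R)%R <> 1%R by lra.
have PA : P A = 2^-1%:E by exact: S1.
have PB : P B = 2^-1%:E by exact: SN1.
have AB0 : P (A `|` B) = 1.
  transitivity (P A + P B); last by rewrite PA PB -EFinD; congr EFin; lra.
  apply: measureU => //; apply/seteqP; split => w //= -[Aw Bw]; apply: N11.
  by rewrite -[LHS]Bw; exact: Aw.
have N0 : P (~` (A `|` B)) = 0.
  by apply: (eq_trans (probability_setC P (measurableU _ _ mA mB))); rewrite AB0 subee.
rewrite (eq_integral_null (N := ~` (A `|` B)) (g := fun w =>
  h 1%R * (\1_A w)%:E + h (-1)%R * (\1_B w)%:E)); first last.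
- move=> w /= /contrapT[Aw|Bw].
    have Bw : ~ B w by move=> Bw; apply: N11; rewrite -[LHS]Bw; exact: Aw.
    rewrite /indic (mem_set Aw) (memNset Bw)/= mule1 mule0 adde0.
    by congr h; exact: Aw.
  have Aw : ~ A w by move=> Aw; apply: N11; rewrite -[RHS]Aw; apply/esym; exact: Bw.
  rewrite /indic (mem_set Bw) (memNset Aw)/= mule1 mule0 add0e.
  by congr h; exact: Bw.
- apply: emeasurable_funD; apply: emeasurable_funM => //; exact/measurable_EFinP.
- exact: N0.
- by apply: measurableC; exact: measurableU.
rewrite ge0_integralD//; first last.
- by apply: emeasurable_funM => //; exact/measurable_EFinP.
- by move=> w _; rewrite mule_ge0// lee_fin.
- by apply: emeasurable_funM => //; exact/measurable_EFinP.
- by move=> w _; rewrite mule_ge0// lee_fin.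
rewrite !ge0_integralZl//; try exact/measurable_EFinP; try by move=> w _; rewrite lee_fin.
rewrite !integral_indic// !setIT.
transitivity (h 1%R * P A + h (-1)%R * P B) => //; rewrite PA PB.
by rewrite ge0_muleDr// muleC [X in _ + X]muleC.
Qed.

Context (x : {RV P >-> R}) (Y s : nat -> {RV P >-> R}).
Hypothesis indep : mutually_independent P (all_variables x Y s).
Hypothesis s_unif : forall i, uniform_sign (s i).

Definition past (n : nat) : {fset (option (nat + nat))} :=
  [fset i in [seq Some (inl i) | i <- iota 0 n]
          ++ [seq Some (inr i) | i <- iota 0 n]]%fset.

Let mX i : measurable_fun setT (all_variables x Y s i).
Proof. by case: i => [[i|i]|] /=; exact: measurable_funPT. Qed.

Lemma past_Y n i : (i < n)%N -> Some (inl i) \in past n.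
Proof.
by move=> iltn; rewrite in_fset/= mem_cat; apply/orP; left; apply: map_f; rewrite mem_iota.
Qed.

Lemma past_s n i : (i < n)%N -> Some (inr i) \in past n.
Proof.
by move=> iltn; rewrite in_fset/= mem_cat; apply/orP; right; apply: map_f; rewrite mem_iota.
Qed.

Lemma past_future n i : i \in past n ->
  (i != Some (inl n)) && (i != Some (inr n)).
Proof.
rewrite in_fset/= mem_cat => /orP[] /mapP[k +] ->; rewrite mem_iota add0n /= => kn.
  by rewrite andbT; apply/eqP => -[kE]; rewrite kE ltnn in kn.
by apply/eqP => -[kE]; rewrite kE ltnn in kn.
Qed.

(** Independence is used twice: it separates the past from the pair of the [n]-th sign and step,
    then the sign from the step. *)
Lemma expectation_step n (d' : measure_display) (T' : measurableType d')
    (Z : T -> T') (f : T' -> R -> R -> \bar R) :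
  measurable_fun (setT : set (g_sigma_algebraType
    (cylinder (all_variables x Y s) (past n)))) Z ->
  measurable_fun setT (fun t : T' * (R * R) => f t.1 t.2.1 t.2.2) ->
  (forall t e y, 0 <= f t e y) ->
  \int[P]_w f (Z w) (s n w) (Y n w) =
  \int[P]_w (2^-1%:E *
    (\int[P]_v f (Z w) 1%R (Y n v) + \int[P]_v f (Z w) (-1)%R (Y n v))).
Proof.
move=> mZ mf f0.
pose K : {fset (option (nat + nat))} := [fset Some (inl n); Some (inr n)]%fset.
have JK : [disjoint past n & K]%fset.
  apply/fdisjointP => i /past_future /andP[]; rewrite !inE.
  by move=> /negbTE -> /negbTE ->.
rewrite (indep_integral indep mX JK (V := fun w => (s n w, Y n w))
  (f := fun t => f t.1 t.2.1 t.2.2))//; last first.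
  apply/measurable_fun_pair.
    by apply: (measurable_cylinder (i := Some (inr n))); rewrite !inE eqxx orbT.
  by apply: (measurable_cylinder (i := Some (inl n))); rewrite !inE eqxx.
apply: eq_integral => w _ /=.
have mfw : measurable_fun setT (fun t : R * R => f (Z w) t.1 t.2).
  exact: (measurableT_comp mf (measurable_pair1 (Z w))).
have JK' : [disjoint [fset (Some (inr n) : option (nat + nat))]
    & [fset Some (inl n)]]%fset by rewrite fdisjoint1X !inE.
rewrite (indep_integral indep mX JK' (Z := s n) (V := Y n)
  (f := fun t => f (Z w) t.1 t.2))//; first last.
- by apply: (measurable_cylinder (i := Some (inl n))); rewrite !inE eqxx.
- by apply: (measurable_cylinder (i := Some (inr n))); rewrite !inE eqxx.
rewrite (expectation_sign (h := fun e => \int[P]_v f (Z w) e (Y n v)))//.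
  rewrite (_ : (fun e => _) = fubini_F (distribution P (Y n))
      (fun t : R * R => f (Z w) t.1 t.2)).
    exact: measurable_fun_fubini_tonelli_F.
  apply/funext => e; rewrite /fubini_F ge0_integral_distribution//=.
  exact: (measurableT_comp mfw (measurable_pair1 e)).
by move=> r; exact: integral_ge0.
Qed.

End one_step.

(** * Action of one exponential step on exponential functions *)

Section kernel.
Local Open Scope ereal_scope.
Context (d : measure_display) (T : measurableType d) (R : realType)
  (P : probability T R) (Y : {RV P >-> R}) (mu : R).
Hypothesis (mu_gt0 : (0 < mu)%R).
Hypothesis (Y_exp : exponentially_distributed Y mu).

Lemma ge0_expectationZl (k : R) (f : T -> R) : (0 <= k)%R ->
  measurable_fun setT f -> (forall w, (0 <= f w)%R) ->
  \int[P]_w (k * f w)%:E = k%:E * \int[P]_w (f w)%:E.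
Proof.
move=> k0 mf f0; under eq_integral do rewrite EFinM.
rewrite ge0_integralZl_EFin//; first by move=> w _; rewrite lee_fin.
exact/measurable_EFinP.
Qed.

Let me (k : R) : measurable_fun setT (fun w => expR (- k * Y w)).
Proof. by apply: measurableT_comp => //; exact: measurable_funM. Qed.

Lemma kernel_up_stay (a lam v : R) : (0 <= v)%R -> (0 < mu + a + lam)%R ->
  \int[P]_w (expR (- a * Y w) *
     ((0 <= v + 1 * Y w)%R%:R * expR (- lam * (v + 1 * Y w))))%:E
  = (mu / (mu + a + lam) * expR (- lam * v))%:E.
Proof.
move=> v0 h; rewrite (eq_integral_null (measurable_le0 Y)
  (g := fun w => (expR (- lam * v) * expR (- (a + lam) * Y w))%:E)).
- rewrite ge0_expectationZl//; try by move=> *; exact: expR_ge0.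
  rewrite (expectation_exp Y_exp)//; last by rewrite addrA.
  by rewrite -EFinM addrA mulrC.
- exact: exponential_null Y_exp.
- by apply/measurable_EFinP; exact: measurable_funM.
- move=> w /= /negP; rewrite -ltNge => Yw; congr EFin.
  by rewrite mul1r (addr_ge0 v0 (ltW Yw)) mul1r -!expRD; congr expR; ring.
Qed.

(** A downward step survives when [Y <= v]: the full transform minus its tail beyond [v]. The tail
    produces the boundary exponential [expR (- (mu + a) * v)]. *)
Lemma kernel_down_stay (a lam v : R) : (0 <= v)%R -> (0 < mu + a - lam)%R ->
  \int[P]_w (expR (- a * Y w) *
     ((0 <= v + (-1) * Y w)%R%:R * expR (- lam * (v + (-1) * Y w))))%:E
  = (mu / (mu + a - lam) * (expR (- lam * v) - expR (- (mu + a) * v)))%:E.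
Proof.
move=> v0 h; have h' : (0 < mu + (a - lam))%R by rewrite addrA.
have mb : measurable_fun setT (fun w => (v < Y w)%R).
  exact: measurable_fun_ltr.
have mb' : measurable_fun setT (fun w => (Y w <= v)%R).
  exact: measurable_fun_ler.
under eq_integral => w _.
  rewrite (_ : (0 <= v + (-1) * Y w)%R = (Y w <= v)%R); last first.
    by rewrite mulN1r subr_ge0.
  rewrite (_ : (_ * _)%R =
    (expR (- lam * v) * (expR (- (a - lam) * Y w) * (Y w <= v)%R%:R))%R).
    over.
  rewrite mulrCA -expRD [RHS]mulrA -expRD mulrC.
  by congr (expR _ * _)%R; ring.
rewrite ge0_expectationZl ?expR_ge0//; last first.
  by apply: measurable_funM => //; exact: measurable_fun_natb.
have full := expectation_exp Y_exp mu_gt0 h'.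
have tail := expectation_exp_tail Y_exp mu_gt0 h' v0.
have split_int : \int[P]_w (expR (- (a - lam) * Y w))%:E =
    \int[P]_w (expR (- (a - lam) * Y w) * (Y w <= v)%R%:R)%:E +
    \int[P]_w (expR (- (a - lam) * Y w) * (v < Y w)%R%:R)%:E.
  rewrite -ge0_integralD//.
  - apply: eq_integral => w _; rewrite -EFinD -mulrDr; congr EFin.
    by case: leP; rewrite ?addr0 ?add0r mulr1.
  - by apply/measurable_EFinP/measurable_funM => //; exact: measurable_fun_natb.
  - by apply/measurable_EFinP/measurable_funM => //; exact: measurable_fun_natb.
have -> : \int[P]_w (expR (- (a - lam) * Y w) * (Y w <= v)%R%:R)%:E =
    (mu / (mu + (a - lam)) -
     mu / (mu + (a - lam)) * expR (- (mu + (a - lam)) * v))%:E.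
  by rewrite EFinB -tail -full split_int addeK// tail.
rewrite -EFinM; congr EFin.
rewrite (_ : - (mu + a) * v = - lam * v + - (mu + (a - lam)) * v)%R; last by ring.
by rewrite expRD addrA; field; rewrite gt_eqF// addrA.
Qed.

Lemma kernel_up_exit (a c v : R) : (0 <= v)%R ->
  \int[P]_w (expR (- a * Y w) *
     ((v + 1 * Y w < 0)%R%:R * expR (- c * (v + 1 * Y w))))%:E = 0.
Proof.
move=> v0; rewrite (eq_integral_null (measurable_le0 Y) (g := cst 0))//.
- exact: integral0.
- exact: exponential_null Y_exp.
- move=> w /= /negP; rewrite -ltNge => Yw.
  by rewrite ltNge mul1r (addr_ge0 v0 (ltW Yw)) mul0r mulr0.
Qed.

(** Lack of memory: [c] affects the constant only, and the depth enters through the same boundary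
    exponential as in [kernel_down_stay]. *)
Lemma kernel_down_exit (a c v : R) : (0 <= v)%R -> (0 < mu + a - c)%R ->
  \int[P]_w (expR (- a * Y w) *
     ((v + (-1) * Y w < 0)%R%:R * expR (- c * (v + (-1) * Y w))))%:E
  = (mu / (mu + a - c) * expR (- (mu + a) * v))%:E.
Proof.
move=> v0 h; have h' : (0 < mu + (a - c))%R by rewrite addrA.
have mb : measurable_fun setT (fun w => (v < Y w)%R).
  exact: measurable_fun_ltr.
under eq_integral => w _.
  rewrite (_ : (v + (-1) * Y w < 0)%R = (v < Y w)%R); last first.
    by rewrite mulN1r subr_lt0.
  rewrite (_ : (_ * _)%R =
    (expR (- c * v) * (expR (- (a - c) * Y w) * (v < Y w)%R%:R))%R).
    over.
  rewrite mulrCA -expRD [RHS]mulrA -expRD mulrC.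
  by congr (expR _ * _)%R; ring.
rewrite ge0_expectationZl ?expR_ge0//; last first.
  by apply: measurable_funM => //; exact: measurable_fun_natb.
rewrite (expectation_exp_tail Y_exp)// -EFinM addrA; congr EFin.
by rewrite mulrCA -expRD; congr (_ * expR _)%R; ring.
Qed.

End kernel.

(** * Recursion for the weighted Laplace transforms of the walk *)

Section weighted_walk.
Local Open Scope ereal_scope.
Context (d : measure_display) (T : measurableType d) (R : realType)
  (P : probability T R) (x : {RV P >-> R}) (Y s : nat -> {RV P >-> R}) (mu : R).
Hypothesis mu_gt0 : (0 < mu)%R.
Hypothesis indep : mutually_independent P (all_variables x Y s).
Hypothesis Y_exp : forall i, exponentially_distributed (Y i) mu.
Hypothesis s_unif : forall i, uniform_sign (s i).
Context (z a u : R).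
Hypothesis (z_gt0 : (0 < z)%R) (a_ge0 : (0 <= a)%R) (u_ge0 : (0 <= u)%R).

Local Notation S := (walk Y s u).
Local Notation W := (weight Y s z a u).

Let mS n : measurable_fun setT (S n).
Proof. by apply: measurable_walk => i _; exact: measurable_funPT. Qed.

Let mW n : measurable_fun setT (W n).
Proof. by apply: measurable_weight => i _; exact: measurable_funPT. Qed.

Lemma expectation_weight_step n (psi : R -> R) :
  measurable_fun setT psi -> (forall r, (0 <= psi r)%R) ->
  \int[P]_w (W n w * (z * expR (- a * Y n w)) * psi (S n.+1 w))%:E =
  \int[P]_w ((W n w * (z / 2))%:E *
    (\int[P]_v (expR (- a * Y n v) * psi (S n w + 1 * Y n v))%:E +
     \int[P]_v (expR (- a * Y n v) * psi (S n w + (-1) * Y n v))%:E)).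
Proof.
move=> mpsi psi0.
(* The absolute value makes [f] nonnegative at every argument; it is harmless because the weight is
   nonnegative. *)
pose f (t : R * R) (e y : R) : \bar R :=
  (`|t.1| * (z * expR (- a * y)) * psi (t.2 + e * y))%:E.
have mf : measurable_fun setT (fun t : (R * R) * (R * R) => f t.1 t.2.1 t.2.2).
  apply/measurable_EFinP; apply: measurable_funM.
    apply: measurable_funM.
      by apply: measurableT_comp => //; exact: measurableT_comp.
    apply: measurable_funM => //; apply: measurableT_comp => //.
    by apply: measurable_funM => //; exact: measurableT_comp.
  apply: measurableT_comp => //; apply: measurable_funD.
    exact: measurableT_comp.
  by apply: measurable_funM; exact: measurableT_comp.
have f0 t e y : 0 <= f t e y.
  by rewrite lee_fin !mulr_ge0 ?expR_ge0// ltW.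
have W0 w : (0 <= W n w)%R by apply: weight_ge0; exact: ltW.
transitivity (\int[P]_w f (W n w, S n w) (s n w) (Y n w)).
  by apply: eq_integral => w _; rewrite /f/= ger0_norm// walkS.
rewrite (expectation_step indep s_unif (Z := fun w => (W n w, S n w)))//.
- apply: eq_integral => w _.
  have E (e : R) : \int[P]_v f (W n w, S n w) e (Y n v) = (W n w * z)%:E *
      \int[P]_v (expR (- a * Y n v) * psi (S n w + e * Y n v))%:E.
    rewrite -ge0_expectationZl//.
    + by apply: eq_integral => v _; rewrite /f/= ger0_norm// !mulrA.
    + by rewrite mulr_ge0// ltW.
    + apply: measurable_funM.
        by apply: measurableT_comp => //; exact: measurable_funM.
      apply: measurableT_comp => //; apply: measurable_funD => //.
      exact: measurable_funM.
    + by move=> v; rewrite mulr_ge0 ?expR_ge0.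
  rewrite !E -ge0_muleDr; last 2 first.
  + by apply: integral_ge0 => v _; rewrite lee_fin mulr_ge0 ?expR_ge0.
  + by apply: integral_ge0 => v _; rewrite lee_fin mulr_ge0 ?expR_ge0.
  by rewrite muleA -EFinM; congr (_%:E * _); ring.
- apply/measurable_fun_pair.
  + apply: measurable_weight => i iltn.
      by apply: (measurable_cylinder (i := Some (inl i))); exact: past_Y.
    by apply: (measurable_cylinder (i := Some (inr i))); exact: past_s.
  + apply: measurable_walk => i iltn.
      by apply: (measurable_cylinder (i := Some (inl i))); exact: past_Y.
    by apply: (measurable_cylinder (i := Some (inr i))); exact: past_s.
Qed.

Local Notation A lam n := (\int[P]_w (W n w * expR (- lam * S n w))%:E).

Lemma weight_laplace_ge0 lam n : 0 <= A lam n.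
Proof.
apply: integral_ge0 => w _.
by rewrite lee_fin mulr_ge0 ?expR_ge0// weight_ge0// ltW.
Qed.

Let mWexp lam n : measurable_fun setT (fun w => W n w * expR (- lam * S n w))%R.
Proof.
apply: measurable_funM => //; apply: measurableT_comp => //.
exact: measurable_funM.
Qed.

(** Upward steps almost surely do not exit; the constant is [z / 2] times that of
    [kernel_down_exit]. *)
Lemma expectation_exit_term (c : R) n : (c < mu + a)%R ->
  \int[P]_w (exit_term Y s z a u c n w)%:E =
  (z * mu / (2 * (mu + a - c)))%:E * A (mu + a) n.
Proof.
move=> cmua; have h : (0 < mu + a - c)%R by rewrite subr_gt0.
rewrite -ge0_expectationZl//; first last.
- by move=> w; rewrite mulr_ge0 ?expR_ge0// weight_ge0// ltW.
- by rewrite divr_ge0 ?mulr_ge0// ltW.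
rewrite (expectation_weight_step n (psi := fun r => (r < 0)%R%:R * expR (- c * r))%R).
- apply: eq_integral => w _; have [->|W0] := eqVneq (W n w) 0%R.
    by rewrite !mul0r mulr0 mul0e.
  have S0 := weight_walk_ge0 u_ge0 W0.
  rewrite (kernel_up_exit (Y_exp n))// (kernel_down_exit mu_gt0 (Y_exp n))//.
  by rewrite add0e -EFinM; congr EFin; field; rewrite gt_eqF.
- apply: measurable_funM.
    by apply: measurable_fun_natb; exact: measurable_fun_ltr.
  by apply: measurableT_comp => //; exact: measurable_funM.
- by move=> r; rewrite mulr_ge0 ?expR_ge0.
Qed.

(* The kernel of the walk killed below 0 maps [expR (- lam * v)] to a multiple
   of itself minus a multiple of [expR (- (mu + a) * v)]. *)
Lemma weight_laplaceS lam n : (0 <= lam < mu + a)%R ->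
  A lam n.+1 + (z * mu / (2 * (mu + a - lam)))%:E * A (mu + a) n =
  (z * mu * (mu + a) / ((mu + a) ^+ 2 - lam ^+ 2))%:E * A lam n.
Proof.
move=> /andP[lam0 lammua].
have h : (0 < mu + a - lam)%R by rewrite subr_gt0.
have h' : (0 < mu + a + lam)%R by rewrite ltr_wpDr// ltr_wpDr.
have h2 : (0 < (mu + a) ^+ 2 - lam ^+ 2)%R by rewrite subr_sqr mulr_gt0.
have W0 m w : (0 <= W m w)%R by rewrite weight_ge0// ltW.
rewrite -!ge0_expectationZl//; first last.
- by move=> w; rewrite mulr_ge0 ?expR_ge0.
- by rewrite divr_ge0 ?mulr_ge0// ltW.
- by move=> w; rewrite mulr_ge0 ?expR_ge0.
- by rewrite divr_ge0 ?mulr_ge0 ?ltW// ltr_wpDr.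
pose g w := (W n w * (z / 2) * (mu / (mu + a + lam) * expR (- lam * S n w) +
  mu / (mu + a - lam) * (expR (- lam * S n w) - expR (- (mu + a) * S n w))))%R.
have -> : A lam n.+1 = \int[P]_w (g w)%:E.
  transitivity (\int[P]_w (W n w * (z * expR (- a * Y n w)) *
      ((0 <= S n.+1 w)%R%:R * expR (- lam * S n.+1 w)))%:E).
    by apply: eq_integral => w _; rewrite weightS !mulrA.
  rewrite (expectation_weight_step n
    (psi := fun r => (0 <= r)%R%:R * expR (- lam * r))%R).
  - apply: eq_integral => w _; rewrite /g; have [->|Wn0] := eqVneq (W n w) 0%R.
      by rewrite !mul0r mul0e.
    have S0 := weight_walk_ge0 u_ge0 Wn0.
    by rewrite (kernel_up_stay mu_gt0 (Y_exp n))// (kernel_down_stay mu_gt0 (Y_exp n)).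
  - apply: measurable_funM.
      by apply: measurable_fun_natb; exact: measurable_fun_ler.
    by apply: measurableT_comp => //; exact: measurable_funM.
  - by move=> r; rewrite mulr_ge0 ?expR_ge0.
have g0 w : (0 <= g w)%R.
  rewrite /g; have [->|Wn0] := eqVneq (W n w) 0%R; first by rewrite !mul0r.
  have S0 := weight_walk_ge0 u_ge0 Wn0.
  rewrite mulr_ge0//; first by rewrite mulr_ge0// divr_ge0// ltW.
  rewrite addr_ge0//; first by rewrite mulr_ge0 ?expR_ge0// divr_ge0// ltW.
  rewrite mulr_ge0//; first by rewrite divr_ge0// ltW.
  by rewrite subr_ge0 ler_expR !mulNr lerN2 ler_wpM2r// ltW.
have me (k : R) : measurable_fun setT (fun w => expR (- k * S n w)).
  by apply: measurableT_comp => //; exact: measurable_funM.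
have mg : measurable_fun setT g.
  apply: measurable_funM; first exact: measurable_funM.
  by apply: measurable_funD; apply: measurable_funM => //; exact: measurable_funB.
rewrite -ge0_integralD//; first last.
- by apply/measurable_EFinP; exact: measurable_funM.
- move=> w _; rewrite lee_fin mulr_ge0//; last by rewrite mulr_ge0 ?expR_ge0.
  by rewrite divr_ge0 ?mulr_ge0// ltW.
- exact/measurable_EFinP.
- by move=> w _; rewrite lee_fin.
(* The boundary terms cancel, and [1 / (mu + a + lam) + 1 / (mu + a - lam)] is [2 * (mu + a) / ((mu
   + a) ^+ 2 - lam ^+ 2)]. *)
apply: eq_integral => w _; rewrite -EFinD; congr EFin; rewrite /g.
by field; rewrite subr_sqr mulf_neq0 ?gt_eqF.
Qed.

End weighted_walk.

(** * Law of the exit from the half-line *)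

Section exit_sum.
Local Open Scope ereal_scope.
Context (d : measure_display) (T : measurableType d) (R : realType)
  (P : probability T R) (x : {RV P >-> R}) (Y s : nat -> {RV P >-> R}) (mu : R).
Hypothesis mu_gt0 : (0 < mu)%R.
Hypothesis indep : mutually_independent P (all_variables x Y s).
Hypothesis Y_exp : forall i, exponentially_distributed (Y i) mu.
Hypothesis s_unif : forall i, uniform_sign (s i).
Context (z a u : R).
Hypothesis (z_gt0 : (0 < z)%R) (a_ge0 : (0 <= a)%R) (u_ge0 : (0 <= u)%R).

Local Notation S := (walk Y s u).
Local Notation W := (weight Y s z a u).
Local Notation A lam n := (\int[P]_w (W n w * expR (- lam * S n w))%:E).

Let mua_gt0 : (0 < mu + a)%R. Proof. by rewrite ltr_wpDr. Qed.

Let Age0 lam n : 0 <= A lam n. Proof. exact: weight_laplace_ge0. Qed.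

Lemma weight_laplace0 lam : A lam 0%N = (expR (- lam * u))%:E.
Proof.
under eq_integral do rewrite weight0 walk0 mul1r.
transitivity ((expR (- lam * u))%:E * P setT); first exact: integral_cst.
by rewrite probability_setT mule1.
Qed.

Let kappa_gt0 (lam : R) : (lam < mu + a)%R -> (0 < z * mu / (2 * (mu + a - lam)))%R.
Proof. by move=> h; rewrite divr_gt0 ?mulr_gt0// subr_gt0. Qed.

Lemma weight_laplace_fin_num (lam : R) n : (0 <= lam < mu + a)%R ->
  A lam n \is a fin_num.
Proof.
move=> lamb; elim: n => [|n IH]; first by rewrite weight_laplace0.
rewrite ge0_fin_numE//.
apply: (@le_lt_trans _ _
  ((z * mu * (mu + a) / ((mu + a) ^+ 2 - lam ^+ 2))%:E * A lam n)).
  rewrite -(weight_laplaceS mu_gt0 indep)// leeDl// mule_ge0// lee_fin ltW//.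
  by apply: kappa_gt0; case/andP: lamb.
by rewrite -(fineK IH) -EFinM ltry.
Qed.

(** The recursion excludes the exponent [mu + a] itself; finiteness is read off the boundary term of
    the recursion at [lam = 0]. *)
Lemma weight_boundary_fin_num n : A (mu + a) n \is a fin_num.
Proof.
have b0 : (0 <= (0 : R) < mu + a)%R by rewrite lexx.
have k0 := kappa_gt0 mua_gt0.
rewrite ge0_fin_numE//.
rewrite -(@lte_pmul2l _ (z * mu / (2 * (mu + a - 0)))%:E)// ?lte_fin//.
rewrite gt0_muley ?lte_fin//.
apply: (@le_lt_trans _ _
  ((z * mu * (mu + a) / ((mu + a) ^+ 2 - 0 ^+ 2))%:E * A 0 n)).
  by rewrite -(weight_laplaceS mu_gt0 indep)// leeDr.
by rewrite -(fineK (weight_laplace_fin_num n b0)) -EFinM ltry.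
Qed.

Let alpha lam n := fine (A lam n).
Let b n := fine (A (mu + a) n).

Let b_ge0 n : (0 <= b n)%R. Proof. exact: fine_ge0. Qed.
Let alpha_ge0 lam n : (0 <= alpha lam n)%R. Proof. exact: fine_ge0. Qed.

Let alphaS (lam : R) n : (0 <= lam < mu + a)%R ->
  (alpha lam n.+1 + z * mu / (2 * (mu + a - lam)) * b n =
   z * mu * (mu + a) / ((mu + a) ^+ 2 - lam ^+ 2) * alpha lam n)%R.
Proof.
move=> lamb; apply: EFin_inj.
have := weight_laplaceS mu_gt0 indep Y_exp s_unif z_gt0 a_ge0 u_ge0 n lamb.
rewrite -(fineK (weight_laplace_fin_num n.+1 lamb)).
rewrite -(fineK (weight_laplace_fin_num n lamb)).
by rewrite -(fineK (weight_boundary_fin_num n)) -!EFinM -EFinD.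
Qed.

Let alpha_le (lam : R) n : (0 <= lam < mu + a)%R -> (alpha lam n <= alpha 0 n)%R.
Proof.
move=> /[dup] lamb /andP[lam0 _].
have b0 : (0 <= (0 : R) < mu + a)%R by rewrite lexx.
rewrite fine_le ?weight_laplace_fin_num//; apply: ge0_le_integralT => w.
  by rewrite lee_fin mulr_ge0 ?expR_ge0// weight_ge0// ltW.
rewrite lee_fin; have [->|W0] := eqVneq (W n w) 0%R; first by rewrite !mul0r.
apply: ler_wpM2l; first by rewrite weight_ge0// ltW.
rewrite oppr0 mul0r ler_expR mulNr oppr_le0.
by rewrite mulr_ge0// (weight_walk_ge0 u_ge0 W0).
Qed.

(** Dropping the nonnegative boundary term of the recursion at [lam = 0] leaves a geometric
    bound. *)
Let alpha0_le n : (alpha 0 n <= (z * mu / (mu + a)) ^+ n)%R.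
Proof.
have b0 : (0 <= (0 : R) < mu + a)%R by rewrite lexx.
elim: n => [|n IH].
  by rewrite /alpha weight_laplace0 expr0 oppr0 mul0r expR0.
apply: (@le_trans _ _ (z * mu * (mu + a) / ((mu + a) ^+ 2 - 0 ^+ 2) * alpha 0 n)%R).
  by rewrite -alphaS// lerDl mulr_ge0// ltW// kappa_gt0.
rewrite [X in (_ <= X)%R]exprS (_ : z * mu * (mu + a) / _ = z * mu / (mu + a))%R; last first.
  by field; rewrite gt_eqF.
by rewrite ler_wpM2l// divr_ge0 ?mulr_ge0 ?ltW.
Qed.

Let sum_b (lam : R) N : (0 <= lam < mu + a)%R ->
  (lam ^+ 2 = (mu + a) ^+ 2 - z * mu * (mu + a))%R ->
  (z * mu / (2 * (mu + a - lam)) * \sum_(n < N) b n =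
   expR (- lam * u) - alpha lam N)%R.
Proof.
move=> lamb lamE; elim: N => [|N IH].
  by rewrite big_ord0 mulr0 /alpha weight_laplace0 subrr.
rewrite big_ord_recr/= mulrDr IH.
(* The equation for [lam] turns the denominator into [z * mu * (mu + a)], so the multiplier is 1 and
   the sum telescopes. *)
have := alphaS N lamb; rewrite lamE subKr divff ?mul1r => [<-|].
  by rewrite opprD addrA subrK.
by rewrite !mulf_neq0 ?gt_eqF.
Qed.

Let exit_term_b (c : R) n : (c < mu + a)%R ->
  \int[P]_w (exit_term Y s z a u c n w)%:E =
  (z * mu / (2 * (mu + a - c)) * b n)%:E.
Proof.
move=> ca; rewrite (expectation_exit_term mu_gt0 indep)//.
by rewrite [RHS]EFinM fineK// weight_boundary_fin_num.
Qed.

Lemma exit_sum (lam c : R) : (0 < lam < mu + a)%R ->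
  (lam ^+ 2 = (mu + a) ^+ 2 - z * mu * (mu + a))%R -> (c < mu + a)%R ->
  \sum_(n <oo) \int[P]_w (exit_term Y s z a u c n w)%:E =
  ((mu + a - lam) / (mu + a - c) * expR (- lam * u))%:E.
Proof.
move=> /andP[lam0 lama] lamE ca.
have lamb : (0 <= lam < mu + a)%R by rewrite ltW.
(* The remainder vanishes because [lam > 0] forces [z * mu < mu + a], a geometric ratio below 1. *)
have alpha_cvg : alpha lam n @[n --> \oo] --> (0 : R)%R.
  apply: (@squeeze_cvgr _ _ _ _ (cst 0%R) (fun n => (z * mu / (mu + a)) ^+ n)%R).
  - apply: nearW => n; rewrite alpha_ge0/=.
    exact: le_trans (alpha_le _ lamb) (alpha0_le n).
  - exact: cvg_cst.
  - apply: cvg_expr; rewrite ger0_norm; last by rewrite divr_ge0 ?mulr_ge0 ?ltW.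
    rewrite ltr_pdivrMr// mul1r -(ltr_pM2r mua_gt0) -expr2 -subr_gt0 -lamE.
    by rewrite exprn_gt0.
have k0 := kappa_gt0 lama.
(* The exit coefficient and the telescoping one differ only by the factor
   [(mu + a - lam) / (mu + a - c)]. *)
have ratio N : (\sum_(n < N) z * mu / (2 * (mu + a - c)) * b n =
    (mu + a - lam) / (mu + a - c) * (expR (- lam * u) - alpha lam N))%R.
  rewrite -(sum_b N lamb lamE) -mulr_sumr mulrA; congr (_ * _)%R.
  by field; rewrite !subr_eq0 !gt_eqF.
apply/cvg_lim => //.
rewrite (_ : (fun N => _) = EFin \o (fun N =>
    (mu + a - lam) / (mu + a - c) * (expR (- lam * u) - alpha lam N))%R).
  apply: cvg_EFin; first exact: nearW.
  have -> : ((mu + a - lam) / (mu + a - c) * expR (- lam * u) =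
      (mu + a - lam) / (mu + a - c) * (expR (- lam * u) - 0))%R by rewrite subr0.
  by apply: cvgMr; apply: cvgB => //; exact: cvg_cst.
apply/funext => N /=; rewrite big_mkord -ratio -sumEFin.
by apply: eq_bigr => n _; rewrite exit_term_b.
Qed.

(** In the recurrent case [lam = 0] the geometric ratio is 1 and does not make the remainder vanish.
    Dropping it still gives an upper bound. *)
Lemma exit_sum_le (c : R) : z = 1%R -> a = 0%R -> (c < mu + a)%R ->
  \sum_(n <oo) \int[P]_w (exit_term Y s z a u c n w)%:E <= (mu / (mu - c))%:E.
Proof.
move=> z1 a0 ca.
have b0 : (0 <= (0 : R) < mu + a)%R by rewrite lexx.
have c0 : (0 < mu - c)%R by rewrite subr_gt0; rewrite a0 addr0 in ca.
apply: lime_le.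
  by apply: is_cvg_nneseries => n _ _; rewrite exit_term_b// lee_fin mulr_ge0// ltW// kappa_gt0.
apply: nearW => N; rewrite big_mkord.
under eq_bigr do rewrite exit_term_b//.
rewrite sumEFin lee_fin -mulr_sumr.
have := sum_b N b0; rewrite z1 a0 addr0 expr0n/= mul1r -expr2 subrr => /(_ erefl).
rewrite oppr0 mul0r expR0 !addr0 => sb.
rewrite [X in (X <= _)%R](_ : _ = mu / (mu - c) * (mu / (2 * mu) * \sum_(i < N) b i))%R.
  rewrite sb; apply: ler_piMr; first by rewrite divr_ge0// ltW.
  by rewrite gerBl.
by field; rewrite !gt_eqF.
Qed.

End exit_sum.

Section exit_law.
Local Open Scope ereal_scope.
Context (d : measure_display) (T : measurableType d) (R : realType)
  (P : probability T R) (x : {RV P >-> R}) (Y s : nat -> {RV P >-> R}) (mu : R).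
Hypothesis mu_gt0 : (0 < mu)%R.
Hypothesis indep : mutually_independent P (all_variables x Y s).
Hypothesis Y_exp : forall i, exponentially_distributed (Y i) mu.
Hypothesis s_unif : forall i, uniform_sign (s i).
Context (u : R).
Hypothesis u_ge0 : (0 <= u)%R.

Local Notation tau := (exit_time Y s u).
(* Vanishes on the paths that never leave the half-line. *)
Local Notation exit_fun z a c w := ((0 < tau w)%N%:R *
  (z ^+ tau w * expR (- a * travel Y s u w + c * overshoot Y s u w)))%R.

Lemma measurable_exit_fun (z a c : R) : (0 <= z)%R ->
  measurable_fun setT (fun w => (exit_fun z a c w)%:E).
Proof.
move=> z0; under eq_fun do rewrite -nneseries_exit_term//.
apply: ge0_emeasurable_sum => [n w _ _|n _].
  by rewrite lee_fin exit_term_ge0.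
by apply/measurable_EFinP; apply: measurable_exit_term => i; exact: measurable_funPT.
Qed.

Lemma expectation_exit_fun_series (z a c : R) : (0 <= z)%R ->
  \int[P]_w (exit_fun z a c w)%:E =
  \sum_(n <oo) \int[P]_w (exit_term Y s z a u c n w)%:E.
Proof.
move=> z0; under eq_integral do rewrite -nneseries_exit_term//.
rewrite integral_nneseries// => n.
  by apply/measurable_EFinP; apply: measurable_exit_term => i; exact: measurable_funPT.
by move=> w _; rewrite lee_fin exit_term_ge0.
Qed.

(** By lack of memory the overshoot is again exponential of rate [mu], whatever the starting depth;
    [c = 0] gives almost sure exit. *)
Lemma expectation_overshoot (c : R) : (c < mu)%R ->
  \int[P]_w (exit_fun 1%R 0%R c w)%:E = (mu / (mu - c))%:E.
Proof.
move=> cmu; have cmu' : (0 < mu - c)%R by rewrite subr_gt0.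
apply/eqP; rewrite eq_le; apply/andP; split.
  rewrite expectation_exit_fun_series//.
  by apply: (exit_sum_le mu_gt0 indep) => //; rewrite addr0.
(* The lower bound compares with the transient case [z = 1 - lam^2 / mu^2]. *)
set q := integral _ _ _; rewrite leNgt; apply/negP => qlt.
have q0 : 0 <= q.
  by apply: integral_ge0 => w _; rewrite lee_fin !mulr_ge0 ?expR_ge0 ?exprn_ge0.
have qfin : q \is a fin_num by rewrite ge0_fin_numE// (lt_trans qlt)// ltry.
rewrite -(fineK qfin) lte_fin in qlt.
set r := fine q in qlt.
have lower lam : (0 < lam < mu)%R ->
    ((mu - lam) * expR (- lam * u) <= r * (mu - c))%R.
  move=> /andP[lam0 lammu].
  pose z := (1 - lam ^+ 2 / mu ^+ 2)%R.
  have z0 : (0 < z)%R.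
    rewrite subr_gt0 ltr_pdivrMr ?exprn_gt0// mul1r.
    by rewrite ltr_pXn2r// nnegrE ltW.
  have z1 : (z <= 1)%R by rewrite gerBl divr_ge0// exprn_ge0// ltW.
  rewrite -ler_pdivrMr// mulrAC -lee_fin /r fineK//.
  have := exit_sum mu_gt0 indep Y_exp s_unif z0 (lexx 0%R) u_ge0 (lam := lam) (c := c).
  rewrite !addr0 => <-//; first last.
  - by rewrite /z; field; rewrite gt_eqF.
  - by rewrite lam0.
  rewrite -(expectation_exit_fun_series _ _ (ltW z0)); apply: ge0_le_integralT => w.
    by rewrite lee_fin !mulr_ge0 ?expR_ge0 ?exprn_ge0 ?(ltW z0).
  rewrite lee_fin ler_wpM2l// ler_wpM2r ?expR_ge0// expr1n.
  by rewrite exprn_ile1 ?(ltW z0).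
have D0 : (0 < mu - r * (mu - c))%R.
  by rewrite subr_gt0 -ltr_pdivlMr.
(* Expanding, [(mu - lam) * (1 - lam * u)] is at least [mu - k * lam]. The choice of [lam] below
   keeps [k * lam] within half of the gap [mu - r * (mu - c)], which contradicts [lower]; the bound
   [mu / 2] ensures [lam < mu]. *)
pose k := (1 + mu * u)%R.
have k0 : (0 < k)%R by rewrite ltr_pwDl// mulr_ge0// ltW.
pose lam : R := Num.min (mu / 2)%R ((mu - r * (mu - c)) / (2 * k))%R.
have lam0 : (0 < lam)%R by rewrite lt_min !divr_gt0// mulr_gt0.
have lammu : (lam < mu)%R.
  by rewrite gt_min ltr_pdivrMr// ltr_pMr// ltr1n.
have lamk : (lam * (2 * k) <= mu - r * (mu - c))%R.
  by rewrite -ler_pdivlMr ?mulr_gt0// ge_min lexx orbT.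
have := lower lam; rewrite lam0 lammu => /(_ isT).
have e1 : (1 - lam * u <= expR (- lam * u))%R.
  by rewrite -mulNr; exact: expR_ge1Dx.
have e2 : ((mu - lam) * (1 - lam * u) <= (mu - lam) * expR (- lam * u))%R.
  by rewrite ler_wpM2l// subr_ge0 ltW.
have l2 : (0 <= lam * lam * u)%R by rewrite !mulr_ge0// ltW.
rewrite /k in lamk k0 *; nra.
Qed.

(** At [c = 0], [expectation_overshoot] says that the exit event has probability 1. *)
Lemma exit_time_eq0_null :
  measurable [set w | tau w = 0%N] /\ P [set w | tau w = 0%N] = 0.
Proof.
pose N := [set w | tau w = 0%N].
have mN : measurable N.
  have -> : N = \bigcap_n [set w | (0 <= walk Y s u n.+1 w)%R].
    apply/seteqP; split => w /=; first by move/exit_time0 => wge n _; exact: wge.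
    by move=> wge; apply/exit_time0 => n; exact: wge.
  apply: bigcapT_measurable => n.
  have mw : measurable_fun setT (fun w => (0 <= walk Y s u n.+1 w)%R).
    apply: measurable_fun_ler => //.
    by apply: measurable_walk => i _; exact: measurable_funPT.
  have := mw measurableT [set true] Logic.I; rewrite setTI.
  by congr measurable; apply/seteqP; split => w.
split => //.
have c0 : (0 < mu)%R by [].
have := expectation_overshoot c0; rewrite subr0 divff ?gt_eqF//.
under eq_integral => w _.
  rewrite (_ : _ * _ = \1_(~` N) w)%R; last first.
    rewrite /indic expr1n oppr0 mul0r mul0r addr0 expR0 !mulr1.
    case E : (tau w) => [|n]; first by rewrite memNset//= => /(_ E).
    by rewrite mem_set//= /N/= E.
  over.
rewrite integral_indic ?setIT//; last exact: measurableC.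
move=> PNC; have := probability_setC P (measurableC mN).
by rewrite setCK => ->; rewrite [P _]PNC subee.
Qed.

(** The general exit identity, recurrent case included. As [f] is prescribed on exiting paths only,
    the default values of [exit_time] do not matter. *)
Lemma expectation_exit (z a c lam : R) (f : T -> R) :
  (0 < z <= 1)%R -> (0 <= a)%R -> (c < mu + a)%R -> (0 <= lam)%R ->
  (lam ^+ 2 = (mu + a) ^+ 2 - z * mu * (mu + a))%R ->
  (forall w, (0 < tau w)%N -> f w =
    z ^+ tau w * expR (- a * travel Y s u w + c * overshoot Y s u w))%R ->
  \int[P]_w (f w)%:E = ((mu + a - lam) / (mu + a - c) * expR (- lam * u))%:E.
Proof.
move=> /andP[z0 z1] a0 ca lam0 lamE fE.
have [mN N0] := exit_time_eq0_null.
rewrite (eq_integral_null mN (g := fun w => (exit_fun z a c w)%:E)) //; first last.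
- move=> w /= /eqP; rewrite -lt0n => tau0.
  by rewrite fE// tau0 mul1r.
- by apply: measurable_exit_fun; exact: ltW.
have mua0 : (0 < mu + a)%R by rewrite ltr_wpDr.
(* If [lam = 0], then [mu + a = z * mu], and [z <= 1] with [a >= 0] forces [a = 0] and [z = 1]: the
   recurrent case. *)
move: lam0; rewrite le_eqVlt => /predU1P[lam0|lam0].
  have a00 : a = 0%R.
    apply/eqP; rewrite eq_le a0 andbT.
    have : ((mu + a) * (mu + a - z * mu) = 0)%R.
      by rewrite -lam0 expr0n in lamE; rewrite [RHS]lamE; ring.
    move/eqP; rewrite mulf_eq0 gt_eqF//= subr_eq0 => /eqP h.
    by rewrite -(lerD2l mu) addr0 h ler_piMl// ltW.
  have z11 : z = 1%R.
    move: lamE; rewrite -lam0 a00 expr0n addr0 /= => h.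
    have : ((1 - z) * (mu * mu) = 0)%R by rewrite [RHS]h; ring.
    move/eqP; rewrite mulf_eq0 subr_eq0 mulf_eq0 (gt_eqF mu_gt0)/= orbF => /eqP.
    by move=> <-.
  rewrite a00 z11 -lam0 expectation_overshoot; last by rewrite a00 addr0 in ca.
  by rewrite oppr0 mul0r expR0 mulr1 !addr0.
rewrite expectation_exit_fun_series ?ltW//.
apply: (exit_sum mu_gt0 indep) => //; rewrite lam0/=.
rewrite -(ltr_pXn2r (n := 2))// ?nnegrE ?ltW// lamE gtrBl.
by rewrite !mulr_gt0.
Qed.

End exit_law.

(** * Closed forms *)

(* The two quotients compare termwise: [q / 2 <= g], and [1 + e - g] is at most
   the product of the roots because [(1 + e - g) (1 + e + g) = 1 + e]. *)
Lemma closed_form_le (R : rcfType) (e q g : R) :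
  0 < e -> 2 * e < 1 -> 0 <= q -> q < 1 -> q ^+ 2 = 2 * e / (1 + 2 * e) ->
  0 <= g -> g ^+ 2 = e * (1 + e) ->
  (1 + e - g) / (1 + e + g) <=
  Num.sqrt (1 - q) * Num.sqrt (1 / (1 - 2 * e)) / (1 + e + 2^-1 * q).
Proof.
move=> e0 e1 q0 q1 q_sqr g0 gE.
have oe0 : 0 <= 1 + e by lra.
have e2 : 0 < 1 + 2 * e by lra.
have qE : (1 - q) * (1 + q) * (1 + 2 * e) = 1.
  rewrite -subr_sqr expr1n q_sqr; field.
  by rewrite gt_eqF.
have qg : q * (1 + e) <= 2 * g.
  rewrite -(ler_pXn2r (n := 2))// ?nnegrE; [|exact: mulr_ge0|exact: mulr_ge0].
  rewrite !exprMn gE q_sqr -subr_ge0.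
  rewrite (_ : _ - _ = 2 * e * (1 + e) * (1 + 3 * e) / (1 + 2 * e)); last first.
    by field; rewrite gt_eqF.
  by rewrite divr_ge0 ?(ltW e2)// !mulr_ge0//; lra.
have q2g : 2^-1 * q <= g by nra.
have gP : (1 + e - g) * (1 + e + g) = 1 + e by rewrite -subr_sqr gE; ring.
have gle : 0 < 1 + e - g.
  have h : 0 < (1 + e - g) * (1 + e + g) by rewrite gP; lra.
  by rewrite pmulr_lgt0// in h; lra.
set C := _ * Num.sqrt _.
have C0 : 0 <= C by rewrite mulr_ge0 ?sqrtr_ge0.
have CE : C ^+ 2 = (1 - q) / (1 - 2 * e).
  rewrite exprMn !sqr_sqrtr; first by rewrite div1r.
    by rewrite divr_ge0//; lra.
  by lra.
have gC : 1 + e - g <= C.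
  rewrite -(ler_pXn2r (n := 2))// ?nnegrE ?(ltW gle)// CE ler_pdivlMr; last by lra.
  (* Multiplying by these conjugates makes [gP] and [qE] applicable. There remains [(1 + e) ^+ 2 *
     (1 + q) * (1 - 4 * e ^+ 2) <= (1 + e + g) ^+ 2], which follows from [qg]. *)
  have D0 : 0 < (1 + e + g) ^+ 2 * ((1 + q) * (1 + 2 * e)).
    by rewrite !mulr_gt0 ?exprn_gt0//; lra.
  rewrite -(ler_pM2r D0).
  rewrite (_ : (1 + e - g) ^+ 2 * (1 - 2 * e) *
      ((1 + e + g) ^+ 2 * ((1 + q) * (1 + 2 * e))) =
    ((1 + e - g) * (1 + e + g)) ^+ 2 * (1 + q) * (1 - 4 * e ^+ 2)); last by ring.
  rewrite (_ : (1 - q) * ((1 + e + g) ^+ 2 * ((1 + q) * (1 + 2 * e))) =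
    (1 + e + g) ^+ 2 * ((1 - q) * (1 + q) * (1 + 2 * e))); last by ring.
  rewrite gP qE mulr1.
  apply: (@le_trans _ _ ((1 + e) ^+ 2 * (1 + q))); last by nra.
  apply: ler_piMr; first by rewrite mulr_ge0 ?exprn_ge0//; lra.
  by rewrite gerBl mulr_ge0 ?exprn_ge0// ltW.
apply: ler_pM => //; first exact: ltW.
- by rewrite invr_ge0; lra.
- by rewrite lef_pV2 ?posrE; lra.
Qed.

(** * Evaluation of the reflected power, its bound and its approximation *)

Section closed_forms.
Local Open Scope ereal_scope.
Context (d : measure_display) (T : measurableType d) (R : realType)
  (P : probability T R) (x : {RV P >-> R}) (Y s : nat -> {RV P >-> R})
  (beta mu : R).
Hypothesis (beta_gt0 : (0 < beta)%R) (mu_gt0 : (0 < mu)%R).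
Hypothesis indep : mutually_independent P (all_variables x Y s).
Hypothesis x_exp : exponentially_distributed x mu.
Hypothesis Y_exp : forall i, exponentially_distributed (Y i) mu.
Hypothesis s_unif : forall i, uniform_sign (s i).

Local Notation eta := (beta / mu)%R.
Local Notation r := (Num.sqrt (2 * eta / (1 + 2 * eta)) : R)%R.

Let eta_gt0 : (0 < eta)%R. Proof. exact: divr_gt0. Qed.

Let eta2_gt0 : (0 < 1 + 2 * eta)%R.
Proof. by rewrite addr_gt0// mulr_gt0. Qed.

Let r_sqr : (r ^+ 2 = 2 * eta / (1 + 2 * eta))%R.
Proof. by rewrite sqr_sqrtr// divr_ge0 ?(ltW eta2_gt0)// mulr_ge0// ltW. Qed.

Let r_lt1 : (r < 1)%R.
Proof.
by rewrite -[X in (_ < X)%R]sqrtr1 ltr_sqrt// ltr_pdivrMr// mul1r ltrDr.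
Qed.

Lemma step_transformE : step_transform P Y beta = (mu / (mu + 2 * beta))%R.
Proof.
rewrite /step_transform unlock (expectation_exp (Y_exp 0))//.
by rewrite addr_gt0// mulr_gt0.
Qed.

(** For [z = mu / (mu + 2 * beta)] and [a = 0], the root of the exit identity is [lam = mu * r]. *)
Lemma expectation_exit_time (u : R) : (0 <= u)%R ->
  'E_P[fun v => (step_transform P Y beta ^+ exit_time Y s u v)%R] =
  ((1 - r) * expR (- (mu * r) * u))%:E.
Proof.
move=> u0; rewrite unlock step_transformE.
rewrite (expectation_exit mu_gt0 indep Y_exp s_unif u0 (z := mu / (mu + 2 * beta))
  (a := 0%R) (c := 0%R) (lam := mu * r)%R)//.
- congr (_ * _)%:E; rewrite !addr0 subr0; field.
  by rewrite gt_eqF.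
- have h : (0 < mu + 2 * beta)%R by rewrite addr_gt0// mulr_gt0.
  by rewrite divr_gt0//= ler_pdivrMr// mul1r lerDl mulr_ge0// ltW.
- by rewrite addr0.
- by rewrite mulr_ge0 ?sqrtr_ge0// ltW.
- rewrite exprMn r_sqr; field.
  have h : (0 < mu + 2 * beta)%R by rewrite addr_gt0// mulr_gt0.
  by rewrite !gt_eqF.
- by move=> w _; rewrite oppr0 !mul0r addr0 expR0 mulr1.
Qed.

(** Prescribing [f] only where the overshoot is positive covers both the absolute values of the
    upper bound and the exponents of [delta]. *)
Lemma expectation_exp_overshoot (u c : R) (f : T -> R) : (0 <= u)%R ->
  (c < mu)%R ->
  (forall w, (0 < overshoot Y s u w)%R -> f w = expR (c * overshoot Y s u w)) ->
  'E_P[f] = (mu / (mu - c))%:E.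
Proof.
move=> u0 cmu fE; rewrite unlock.
rewrite (expectation_exit mu_gt0 indep Y_exp s_unif u0 (z := 1%R)
  (a := 0%R) (c := c) (lam := 0%R))//.
- by congr EFin; rewrite oppr0 mul0r expR0 mulr1 !addr0.
- by rewrite ltr01 lexx.
- by rewrite addr0.
- by rewrite expr0n/=; ring.
- by move=> w T0; rewrite fE ?overshoot_gt0// expr1n mul1r oppr0 mul0r add0r.
Qed.

(** The outer expectation: in each quantity the inner one turns out to be a pure exponential of the
    depth. *)
Lemma integral_over_depth (f : R -> \bar R) (C k : R) : (0 <= C)%R -> (0 <= k)%R ->
  (forall v, (0 < v)%R -> f v = (C * expR (- k * v))%:E) ->
  \int[P]_w f (x w) = (C * (mu / (mu + k)))%:E.
Proof.
move=> C0 k0 fE.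
have me : measurable_fun setT (fun w => expR (- k * x w)).
  by apply: measurableT_comp => //; exact: measurable_funM.
rewrite (eq_integral_null (measurable_le0 x)
  (g := fun w => (C * expR (- k * x w))%:E)).
- by rewrite ge0_expectationZl// (expectation_exp x_exp)// ltr_wpDr.
- exact: exponential_null x_exp.
- by apply/measurable_EFinP; exact: measurable_funM.
- by move=> w /= /negP; rewrite -ltNge => /fE.
Qed.

Local Notation l := (Num.sqrt (beta * (mu + beta)) : R).

(** The exit identity at [z = 1] and [a = c = beta], whose root satisfies
    [lam ^+ 2 = beta * (mu + beta)]. *)
Lemma rhoE : rho P x Y s beta = ((mu + beta - l) / mu * (mu / (mu + (beta + l))))%:E.
Proof.
have mb0 : (0 <= mu + beta)%R by rewrite addr_ge0// ltW.
have l_sqr : (l ^+ 2 = beta * (mu + beta))%R.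
  by rewrite sqr_sqrtr// mulr_ge0// ltW.
have l_le : (l <= mu + beta)%R.
  rewrite -(ler_pXn2r (n := 2))// ?nnegrE ?sqrtr_ge0// l_sqr expr2.
  by rewrite ler_wpM2r// lerDr ltW.
apply: (integral_over_depth (f := fun v => (expR (- beta * v))%:E *
  'E_P[fun w => expR (- beta * travel Y s v w + beta * `|overshoot Y s v w|)%R])).
- by rewrite divr_ge0 ?subr_ge0// ltW.
- by rewrite addr_ge0 ?sqrtr_ge0// ltW.
- move=> v v0; rewrite unlock.
  rewrite (expectation_exit mu_gt0 indep Y_exp s_unif (ltW v0) (z := 1%R)
    (a := beta) (c := beta) (lam := l))//.
  + rewrite -EFinM mulrCA -expRD addrK; congr (_ * expR _)%:E; ring.
  + by rewrite ltr01 lexx.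
  + exact: ltW.
  + by rewrite ltrDr.
  + by rewrite l_sqr; ring.
  + by move=> w T0; rewrite gtr0_norm ?overshoot_gt0// expr1n mul1r.
Qed.

(** The square root halves the decay rate [mu * r] of the exit-time factor. The overshoot factor
    does not depend on the depth and is finite since [2 * beta < mu]. *)
Lemma rho_upperE : (2 * eta < 1)%R -> rho_upper P x Y s beta =
  (Num.sqrt (1 - r) * Num.sqrt (1 / (1 - 2 * eta)) / (1 + eta + 2^-1 * r))%:E.
Proof.
move=> eta1; have bmu : (2 * beta < mu)%R by rewrite mulrA ltr_pdivrMr ?mul1r in eta1.
have eta1' : (0 < 1 - 2 * eta)%R by rewrite subr_gt0.
have r1 : (0 <= 1 - r)%R by rewrite subr_ge0 ltW.
rewrite /rho_upper (@integral_over_depth (fun v => (expR (- beta * v)%R)%:E *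
    sqrte ('E_P[fun w => (step_transform P Y beta ^+ exit_time Y s v w)%R] *
           'E_P[fun w => expR (2 * beta * `|overshoot Y s v w|)%R]))
  (Num.sqrt (1 - r) * Num.sqrt (1 / (1 - 2 * eta)))%R (beta + mu * r / 2)%R).
- congr EFin; congr (_ * _)%R.
  have r0 := sqrtr_ge0 (2 * eta / (1 + 2 * eta))%R.
  move: r0; set q := (Num.sqrt _ : R) => q0.
  field; rewrite !gt_eqF//.
  by rewrite ltr_wpDr ?(mulr_ge0 q0 (ltW mu_gt0))// mulr_gt0// addr_gt0.
- by rewrite mulr_ge0 ?sqrtr_ge0.
- by rewrite addr_ge0 ?mulr_ge0 ?sqrtr_ge0 ?(ltW mu_gt0) ?(ltW beta_gt0).
- move=> v v0; rewrite expectation_exit_time ?(ltW v0)//.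
  rewrite (expectation_exp_overshoot (u := v) (c := 2 * beta))%R ?(ltW v0)//.
  + rewrite -EFinM /= (_ : (mu / (mu - 2 * beta) = 1 / (1 - 2 * eta))%R); last first.
      field; rewrite !gt_eqF// subr_gt0//.
    rewrite mulrAC sqrtrM; last by rewrite mulr_ge0// divr_ge0// ltW.
    rewrite sqrtrM//.
    have -> : Num.sqrt (expR (- (mu * r) * v)) = expR (- (mu * r / 2) * v).
      rewrite (_ : expR _ = expR (- (mu * r / 2) * v) ^+ 2)%R.
        by rewrite sqrtr_sqr ger0_norm ?expR_ge0.
      by rewrite -expRM_natl; congr expR; field.
    rewrite mulrCA -expRD; congr (_ * expR _)%:E; ring.
  + by move=> w Z0; rewrite gtr0_norm.
Qed.

Lemma rho_le_rho_upper : (2 * eta < 1)%R ->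
  rho P x Y s beta <= rho_upper P x Y s beta.
Proof.
move=> eta1; rewrite rhoE rho_upperE// lee_fin.
have mb0 : (0 < mu + beta)%R by rewrite addr_gt0.
rewrite (_ : (mu + beta - l) / mu * _ =
    (1 + eta - l / mu) / (1 + eta + l / mu))%R; last first.
  have := sqrtr_ge0 (beta * (mu + beta)); move: (Num.sqrt _) => k k0.
  by field; rewrite !gt_eqF//; lra.
(* Here [e = eta], [q = r] and [g = l / mu]. *)
apply: closed_form_le => //.
- by rewrite divr_ge0 ?sqrtr_ge0// ltW.
- rewrite expr_div_n sqr_sqrtr ?mulr_ge0 ?ltW//.
  by field; rewrite gt_eqF.
Qed.

(* Only positivity matters, as [delta] does not depend on its parameter [m > 0];
   it uses [x <= 2 / mu * e^(mu x / 2)] and [1 <= x + e^(- x)]. *)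
Lemma expectation_depth_gt0 (c : R) : (0 < c)%R ->
  (0 < fine 'E_P[fun w => x w * c])%R.
Proof.
move=> c0; have me (k : R) : measurable_fun setT (fun w => expR (k * x w)).
  by apply: measurableT_comp => //; exact: measurable_funM.
pose g w := (x w * c * (0 < x w)%R%:R)%R.
have mg : measurable_fun setT g.
  apply: measurable_funM; first exact: measurable_funM.
  by apply: measurable_fun_natb; exact: measurable_fun_ltr.
have g0 w : (0 <= g w)%R.
  rewrite /g; case: ltP => xw; last by rewrite mulr0.
  by rewrite mulr1 mulr_ge0// ltW.
have -> : 'E_P[fun w => x w * c]%R = \int[P]_w (g w)%:E.
  rewrite unlock; apply: (eq_integral_null (measurable_le0 x)).
  - exact: exponential_null x_exp.
  - exact/measurable_EFinP.
  - by move=> w /= /negP; rewrite -ltNge /g => ->; rewrite mulr1.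
(* An infinite mean would be sent to 0 by [fine], so finiteness comes before positivity. *)
have gfin : \int[P]_w (g w)%:E \is a fin_num.
  rewrite ge0_fin_numE; last by apply: integral_ge0 => w _; rewrite lee_fin.
  apply: (@le_lt_trans _ _
      (\int[P]_w (2 * c / mu * expR (- - (mu / 2) * x w))%:E)).
    apply: ge0_le_integralT => w; first by rewrite lee_fin.
    rewrite lee_fin /g; case: ltP => xw; last first.
      by rewrite mulr0 mulr_ge0 ?expR_ge0// divr_ge0 ?mulr_ge0 ?ltW.
    rewrite mulr1 mulrAC ler_pdivlMr// opprK.
    have h := expR_ge1Dx (mu / 2 * x w).
    have -> : (x w * c * mu = 2 * c * (mu / 2 * x w))%R by field.
    by rewrite ler_pM2l ?mulr_gt0//; lra.
  rewrite ge0_expectationZl//; last by rewrite divr_ge0 ?mulr_ge0 ?ltW.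
  rewrite (expectation_exp x_exp)//; last by rewrite subr_gt0 ltr_pdivrMr// ltr_pMr// ltr1n.
  by rewrite -EFinM ltry.
rewrite -lte_fin fineK//.
have : c%:E <= \int[P]_w ((g w)%:E + (c * expR (- 1 * x w))%:E).
  have -> : c%:E = \int[P]_w (cst c%:E w).
    by rewrite integral_cst// [X in _ * X]probability_setT mule1.
  apply: ge0_le_integralT => w /=; first by rewrite lee_fin ltW.
  rewrite -EFinD lee_fin /g; have h := expR_ge1Dx (- 1 * x w).
  by case: ltP => xw; rewrite ?mulr1 ?mulr0; nra.
rewrite ge0_integralD//; first last.
- by apply/measurable_EFinP; exact: measurable_funM.
- by move=> w _; rewrite lee_fin mulr_ge0 ?expR_ge0// ltW.
- exact/measurable_EFinP.
- by move=> w _; rewrite lee_fin.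
rewrite ge0_expectationZl ?(ltW c0)//.
rewrite (expectation_exp x_exp)//; last by rewrite addr_gt0.
rewrite -(fineK gfin) -EFinM -EFinD lee_fin lte_fin => h.
have mu1 : (0 < mu + 1)%R by rewrite addr_gt0.
have h2 : (c * (mu / (mu + 1)) < c)%R.
  by rewrite gtr_pMr// ltr_pdivrMr// mul1r ltrDl.
by lra.
Qed.

(** With [t = eps / m], the exponential law of the overshoot makes the difference quotient
    [- mu / ((mu + 2 * t) * (mu + t))]; its limit is minus the mean overshoot. *)
Lemma deltaE (m u : R) : (0 < m)%R -> (0 <= u)%R ->
  delta P Y s m u = (- mu^-1)%:E.
Proof.
move=> m0 u0; apply/cvg_lim => //.
pose h (eps : R) := (- mu / ((mu + 2 * eps / m) * (mu + eps / m)))%R.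
have hcvg : h eps @[eps --> (0%R : R)^'+] --> (- mu^-1)%R.
  have -> : (- mu^-1 = h 0)%R by rewrite /h; field; rewrite !gt_eqF.
  apply: cvg_at_right_filter; apply: cvgM; first exact: cvg_cst.
  apply: cvgV; first by rewrite !mulr0 !mul0r !addr0 mulf_neq0 ?gt_eqF.
  have cD (k : R) : (mu + k * eps / m)%R @[eps --> 0%R] --> (mu + k * 0 / m)%R.
    apply: cvgD; first exact: cvg_cst.
    by apply: cvgM; [apply: cvgM; [exact: cvg_cst|exact: cvg_id]|exact: cvg_cst].
  apply: cvgM; first exact: cD.
  by have := cD 1%R; rewrite !mul1r; under eq_fun do rewrite mul1r.
have : (h eps)%:E @[eps --> (0%R : R)^'+] --> (- mu^-1)%:E.
  by apply: cvg_EFin; [exact: nearW|exact: hcvg].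
apply: cvg_trans; apply: near_eq_cvg; near=> eps.
have eps0 : (0 < eps)%R by near: eps; exact: nbhs_right_gt.
have em0 : (0 < eps / m)%R by rewrite divr_gt0.
rewrite (expectation_exp_overshoot u0 (c := - (2 * eps) / m)%R); last 2 first.
- by rewrite mulNr (lt_trans _ mu_gt0)// oppr_lt0 divr_gt0 ?mulr_gt0.
- by move=> w _; rewrite mulrAC.
rewrite (expectation_exp_overshoot u0 (c := - eps / m)%R); last 2 first.
- by rewrite mulNr (lt_trans _ mu_gt0)// oppr_lt0.
- by move=> w _; rewrite mulrAC.
rewrite -EFinB -EFinM; congr EFin; rewrite /h; field.
have mueps : (0 < mu * m + eps)%R by rewrite addr_gt0 ?mulr_gt0.
have mueps2 : (0 < mu * m + 2 * eps)%R by rewrite addr_gt0 ?mulr_gt0.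
by rewrite !gt_eqF//; lra.
Unshelve. all: by end_near. Qed.

(** The delta factor is the constant [1 + eta], and the remaining integrand decays in the depth at
    rate [(beta + mu * r) * cos theta]. The range of [theta] makes the cosine positive. *)
Lemma rho_hatE (theta : R) : (0 <= theta < pi / 2)%R ->
  rho_hat P x Y s beta theta =
    ((1 - r) * (1 + (eta + r) * cos theta)^-1 * (1 + eta))%:E.
Proof.
move=> /andP[theta0 thetapi]; pose c := cos theta.
have c0 : (0 < c)%R.
  apply: cos_gt0_pihalf; rewrite thetapi andbT (lt_le_trans _ theta0)//.
  by rewrite oppr_lt0 divr_gt0// pi_gt0.
rewrite /rho_hat -/c /=.
have := expectation_depth_gt0 c0; set m := fine _ => m0.
have r0 : (0 <= r)%R by exact: sqrtr_ge0.
rewrite (@integral_over_depth (fun v => (expR (- beta * (v * c))%R)%:E *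
    'E_P[fun w => (step_transform P Y beta ^+ exit_time Y s (v * c) w)%R] *
    (1 - beta%:E * delta P Y s m (v * c)))
  ((1 - r) * (1 + eta))%R ((beta + mu * r) * c)%R).
- have h : (0 < mu + (beta + r * mu) * c)%R.
    by rewrite ltr_wpDr// mulr_ge0 ?(ltW c0)// addr_ge0 ?mulr_ge0 ?(ltW mu_gt0) ?(ltW beta_gt0).
  congr EFin; rewrite mulrAC; congr (_ * _ * _)%R.
  by field; rewrite !gt_eqF.
- by rewrite mulr_ge0 ?subr_ge0 ?(ltW r_lt1)// addr_ge0// ltW.
- by rewrite mulr_ge0 ?(ltW c0)// addr_ge0 ?mulr_ge0 ?(ltW mu_gt0) ?(ltW beta_gt0).
- move=> v v0; have vc0 : (0 <= v * c)%R by rewrite mulr_ge0// ltW.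
  rewrite expectation_exit_time// deltaE//.
  rewrite (_ : 1 - _ = (1 + eta)%:E); last first.
    by transitivity (1 - beta * - mu^-1)%:E => //; congr EFin; ring.
  rewrite -!EFinM; congr EFin.
  rewrite [in RHS](_ : - _ * v = - beta * (v * c) + - (mu * r) * (v * c))%R; last by ring.
  by rewrite expRD; ring.
Qed.

End closed_forms.

Theorem theorem2 (d : measure_display) (T : measurableType d) (R : realType)
    (P : probability T R) (x : {RV P >-> R}) (Y s : nat -> {RV P >-> R})
    (beta mu : R)
    (beta_gt0 : 0 < beta) (mu_gt0 : 0 < mu)
    (indep : mutually_independent P (all_variables x Y s))
    (x_exp : exponentially_distributed x mu)
    (Y_exp : forall i, exponentially_distributed (Y i) mu)
    (s_unif : forall i, uniform_sign (s i)) :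
  let eta := beta / mu in
  let r := Num.sqrt (2 * eta / (1 + 2 * eta)) in
  [/\ 2 * eta < 1 ->
        (rho P x Y s beta <= rho_upper P x Y s beta)%E /\
        rho_upper P x Y s beta =
          (Num.sqrt (1 - r) * Num.sqrt (1 / (1 - 2 * eta))
           / (1 + eta + 2^-1 * r))%:E,
      rho_hat P x Y s beta 0 =
        ((1 - r) / (eta + 1 + r) * (1 + eta))%:E
    & forall theta : R, 0 <= theta < pi / 2 ->
        rho_hat P x Y s beta theta =
          ((1 - r) * (1 + (eta + r) * cos theta)^-1 * (1 + eta))%:E].
Proof.
move=> eta r; split.
- by move=> eta1; split; [exact: (rho_le_rho_upper beta_gt0 mu_gt0 indep x_exp Y_exp s_unif eta1)|exact: (rho_upperE _ _ indep)].
- rewrite (rho_hatE beta_gt0 mu_gt0 indep)//; last by rewrite lexx divr_gt0 ?pi_gt0.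
  by rewrite cos0 mulr1 -/eta -/r; congr (_ / _ * _)%:E; ring.
- by move=> theta; exact: (rho_hatE _ _ indep).
Qed.
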